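(* Let $d\ge2$. Suppose $f(x',v)\equiv f(v)$ is $1$-periodic in $v$, $f\in C^\alpha(\mathbb{R})$ for some $\alpha>0$, and $\langle f\rangle=\int_0^1f(r)\,dr=0$. Then for every $p\in\mathbb{R}^{d-1}$, $$Q_*(p)=\begin{cases}\min f&\text{if }p=0,\\ \langle f\rangle=0&\text{if }p\ne0,\end{cases}\qquad Q^*(p)=\begin{cases}\max f&\text{if }p=0,\\ \langle f\rangle=0&\text{if }p\ne0,\end{cases}$$ where $Q_*(p)$ and $Q^*(p)$ are the homogenized coefficients of $f$ defined in the context.
   Context: Notation: $x=(x_1,x')\in\mathbb{R}\times\mathbb{R}^{d-1}$, $\mathbb{R}^d_+=\{x_1>0\}$, $\partial\mathbb{R}^d_+=\{x_1=0\}$, $(\mu,p)\cdot x=\mu x_1+p\cdot x'$ for $(\mu,p)\in\mathbb{R}\times\mathbb{R}^{d-1}$. Corrector equation: $\Delta v=0$ in $\mathbb{R}^d_+$, $\partial_1v=f(v)$ on $\partial\mathbb{R}^d_+$. An upper semicontinuous $v:\overline{\mathbb{R}^d_+}\to[-\infty,\infty)$ is a viscosity subsolution if whenever a smooth $\phi$ touches $v$ from above at $x_0$ (i.e. $v-\phi$ has a local maximum equal to $0$ at $x_0$ relative to $\overline{\mathbb{R}^d_+}$), either $\Delta\phi(x_0)\ge0$, or $x_0\in\partial\mathbb{R}^d_+$ and $\partial_1\phi(x_0)\ge f(v(x_0))$. A lower semicontinuous $v:\overline{\mathbb{R}^d_+}\to(-\infty,\infty]$ is a viscosity supersolution if whenever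 a smooth $\phi$ touches $v$ from below at $x_0$, either $\Delta\phi(x_0)\le0$, or $x_0\in\partial\mathbb{R}^d_+$ and $\partial_1\phi(x_0)\le f(v(x_0))$. $(v,\mu,p)$ is a subcorrector if $v$ is a viscosity subsolution, $v(x)\le(\mu,p)\cdot x+C$ on $\overline{\mathbb{R}^d_+}$ for some $C>0$, and $v(0)>-\infty$. $(v,\mu,p)$ is a supercorrector if $v$ is a viscosity supersolution, $v(x)\ge(\mu,p)\cdot x-C$ on $\overline{\mathbb{R}^d_+}$ for some $C>0$, and $v(0)<+\infty$. $Q_*(p)=\inf\{\mu:\ (v,\mu,p)\text{ is a subcorrector for some }v\}$ and $Q^*(p)=\sup\{\mu:\ (v,\mu,p)\text{ is a supercorrector for some }v\}$. *)

(* Defs.v *)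
From HB Require Import structures.
From mathcomp Require Import all_boot all_order all_algebra.
From mathcomp Require Import all_classical all_reals all_analysis.
Set Implicit Arguments.
Unset Strict Implicit.
Unset Printing Implicit Defensive.
Import Order.TTheory GRing.Theory Num.Theory.
Import numFieldNormedType.Exports.

Local Open Scope classical_set_scope.
Local Open Scope ring_scope.

(* The space dimension is n.+1: a point of R^(n.+1) is a row vector
   x : 'rV_n.+1 whose coordinate ord0 is x_1 and whose coordinates
   lift ord0 i (i < n) are those of x'. *)
Section corrector.
Context {R : realType} {n : nat}.
Implicit Types (x : 'rV[R]_n.+1) (phi : 'rV[R]_n.+1 -> R).
Implicit Types (v : 'rV[R]_n.+1 -> \bar R) (f : R -> R).

Definition half_space : set 'rV[R]_n.+1 := [set x | 0 <= x ord0 ord0].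

Definition half_space_boundary : set 'rV[R]_n.+1 := [set x | x ord0 ord0 = 0].

(* (mu, p) . x = mu x_1 + p . x' *)
Definition slope (mu : R) (p : 'rV[R]_n) x : R :=
  mu * x ord0 ord0 + \sum_(i < n) p ord0 i * x ord0 (lift ord0 i).

Definition partial (i : 'I_n.+1) phi : 'rV[R]_n.+1 -> R :=
  'D_(delta_mx ord0 i : 'rV[R]_n.+1) phi.

Definition laplacian phi x : R := \sum_(i < n.+1) partial i (partial i phi) x.

Fixpoint Ck (k : nat) phi : Prop :=
  continuous phi /\
  if k is k'.+1 then
    forall i : 'I_n.+1,
      (forall x, derivable phi x (delta_mx ord0 i)) /\ Ck k' (partial i phi)
  else True.

Definition smooth phi : Prop := forall k, Ck k phi.

(* The unknowns v are functions on the closed half space; they are encoded as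
   functions on the whole space, whose values off the half space are never
   constrained: points outside A are isolated in subspace A. *)
Definition lsc_half_space v : Prop :=
  lower_semicontinuous (v : subspace half_space -> \bar R).

Definition usc_half_space v : Prop :=
  lsc_half_space (fun x => (- v x)%E).

Definition touches_above phi v x0 : Prop :=
  [/\ half_space x0, v x0 = (phi x0)%:E
    & \forall x \near within half_space (nbhs x0), (v x <= (phi x)%:E)%E].

Definition touches_below phi v x0 : Prop :=
  [/\ half_space x0, v x0 = (phi x0)%:E
    & \forall x \near within half_space (nbhs x0), ((phi x)%:E <= v x)%E].

(* At a touching point v x0 is finite, so fine (v x0) is the real v(x0). *)
Definition viscosity_subsolution f v : Prop :=
  [/\ (forall x, half_space x -> v x != +oo%E),
      usc_half_space v
    & forall phi x0, smooth phi -> touches_above phi v x0 ->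
        0 <= laplacian phi x0 \/
        (half_space_boundary x0 /\ f (fine (v x0)) <= partial ord0 phi x0)].

Definition viscosity_supersolution f v : Prop :=
  [/\ (forall x, half_space x -> v x != -oo%E),
      lsc_half_space v
    & forall phi x0, smooth phi -> touches_below phi v x0 ->
        laplacian phi x0 <= 0 \/
        (half_space_boundary x0 /\ partial ord0 phi x0 <= f (fine (v x0)))].

Definition subcorrector f v (mu : R) (p : 'rV[R]_n) : Prop :=
  [/\ viscosity_subsolution f v,
      (exists2 C : R, 0 < C &
         forall x, half_space x -> (v x <= (slope mu p x + C)%:E)%E)
    & v 0 != -oo%E].

Definition supercorrector f v (mu : R) (p : 'rV[R]_n) : Prop :=
  [/\ viscosity_supersolution f v,
      (exists2 C : R, 0 < C &
         forall x, half_space x -> ((slope mu p x - C)%:E <= v x)%E)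
    & v 0 != +oo%E].

(* Q_*(p) and Q^*(p), as extended reals *)
Definition Q_low f (p : 'rV[R]_n) : \bar R :=
  ereal_inf [set mu%:E | mu in [set mu : R | exists v, subcorrector f v mu p]].

Definition Q_up f (p : 'rV[R]_n) : \bar R :=
  ereal_sup [set mu%:E | mu in [set mu : R | exists v, supercorrector f v mu p]].

End corrector.

(* C^alpha(R) for arbitrary alpha > 0: with alpha = k + b, k a natural number
   and 0 < b <= 1, the k-th derivative is b-Hoelder. Integer exponents thus
   denote C^(k,1). Bounds on the lower derivatives are not required; they are
   automatic for periodic f. *)
Definition holder_class {R : realType} (alpha : R) (f : R -> R) : Prop :=
  exists (k : nat) (b : R),
    [/\ 0 < b <= 1, alpha = k%:R + b,
        (forall j (x : R), (j < k)%N -> derivable (derive1n j f) x 1)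
      & exists K : R, forall x y,
          `|derive1n k f x - derive1n k f y| <= K * (`|x - y| `^ b)].

Definition mean {R : realType} (f : R -> R) : R :=
  \int[lebesgue_measure]_(r in `[0, 1]) f r.

Definition is_min {R : realType} (f : R -> R) (m : R) : Prop :=
  (exists r, f r = m) /\ forall r, m <= f r.

Definition is_max {R : realType} (f : R -> R) (M : R) : Prop :=
  (exists r, f r = M) /\ forall r, f r <= M.

(* Main.v *)
Require Import Defs.
From HB Require Import structures.
From mathcomp Require Import all_boot all_order all_algebra.
From mathcomp Require Import all_classical all_reals all_analysis.
From mathcomp Require Import ring lra.
Import Order.TTheory GRing.Theory Num.Theory.
Import numFieldNormedType.Exports.
Local Open Scope classical_set_scope.
Local Open Scope ring_scope.

(** Supercorrectors are reduced to subcorrectors by the change of unknown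
    [v |-> - v] ([Q_up_reflect]).

    For [p = 0] the function [m x_1 + t] with [f t = m = min f] is a subcorrector of
    slope [m], and a comparison argument shows that no subcorrector has a
    smaller slope.

    For [p != 0] the claim is that there are planar correctors of slope 0, of the
    form [s + psi s] with [s = p . x'] on the boundary and [psi] 1-periodic,
    extended harmonically. The boundary condition becomes
    [- Lambda psi = f (s + psi s)], where [Lambda] is the Fourier multiplier
    [2 pi |p| |k|]. This is the Euler-Lagrange equation of the energy
    [1/2 <Lambda psi, psi> + int F (s + psi s)], where [F' = f]; the zero mean
    of [f] makes [F] periodic, hence bounded, and the energy has minimisers. It
    is enough to solve the equation up to a uniformly small error
    ([approximate_corrector]), with trigonometric polynomials, which extend to
    functions that are smooth on the whole space and so are admissible test
    functions. To this end the energy is minimised over trigonometric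
    polynomials of degree [N], with the integral replaced by an average over
    equispaced nodes and with the modes weighted by the Fejer coefficients
    ([galerkin_trig]). The minimiser solves the equation with [f (s + psi s)]
    replaced by its Fejer mean. Parseval gives a modulus of continuity for [psi]
    uniform in [N] ([galerkin_modulus]), so that the Fejer mean is uniformly
    close to the function itself ([fejer_approximation]).

    Tilted by [e x_1], such an approximate corrector is a smooth subcorrector
    of slope [e] ([smooth_subcorrector]); tilted by [- e x_1], it is a smooth
    supersolution, and sliding it along the boundary until it touches a given
    subcorrector shows that the latter has slope at least [- e]
    ([subcorrector_slope_ge]). *)

Set Implicit Arguments.
Unset Strict Implicit.
Unset Printing Implicit Defensive.

(** * Trigonometric sums over equispaced nodes and the Fejer kernel *)

Lemma cos_add2pin (R : realType) (x : R) (k : nat) :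
  cos (x + 2 * pi * k%:R) = cos x.
Proof.
have -> : 2 * pi * k%:R = pi *+ 2 *+ k :> R.
  by rewrite mulr_natr mulr_natl.
exact: (periodicn (@cosD2pi R)).
Qed.

Lemma sin_add2pin (R : realType) (x : R) (k : nat) :
  sin (x + 2 * pi * k%:R) = sin x.
Proof.
have -> : 2 * pi * k%:R = pi *+ 2 *+ k :> R.
  by rewrite mulr_natr mulr_natl.
exact: (periodicn (@sinD2pi R)).
Qed.

(** Multiplying by [2 sin (pi k / M)], which does not vanish for [0 < k < M],
    makes the sum telescope over one full period. The free phase [y] lets one
    lemma serve both sines and cosines, and all products of them. *)
Lemma sum_cos_equispaced (R : realType) (M k : nat) (y : R) :
  (0 < k < M)%N -> \sum_(j < M) cos (y - 2 * pi * k%:R * (j%:R / M%:R)) = 0.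
Proof.
move=> /andP[k0 kM].
have M0 : (0 < M%:R :> R) by rewrite ltr0n (leq_ltn_trans _ kM).
have Mn0 : M%:R != 0 :> R by rewrite gt_eqF.
pose al : R := pi * k%:R / M%:R.
have al_gt0 : 0 < sin al.
  apply: sin_gt0_pi; apply/andP; split.
    by rewrite !mulr_gt0 ?pi_gt0 ?ltr0n ?invr_gt0.
  by rewrite ltr_pdivrMr// ltr_pM2l ?pi_gt0// ltr_nat.
have tel n : 2 * sin al * \sum_(j < n) cos (y - 2 * pi * k%:R * (j%:R / M%:R))
    = sin (y + al) - sin (y + al - 2 * al * n%:R).
  elim: n => [|n IH]; first by rewrite big_ord0 mulr0 mulr0 subr0 subrr.
  rewrite big_ord_recr/= mulrDr IH.
  have -> : y + al - 2 * al * n.+1%:R =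
      (y - 2 * pi * k%:R * (n%:R / M%:R)) - al.
    by rewrite /al -natr1; field.
  have -> : y + al - 2 * al * n%:R =
      (y - 2 * pi * k%:R * (n%:R / M%:R)) + al.
    by rewrite /al; field.
  set T := y - _; rewrite (sinD T al) (sinB T al); ring.
have := tel M.
have -> : 2 * al * M%:R = 2 * pi * k%:R by rewrite /al; field.
rewrite -{1}[y + al](subrK (2 * pi * k%:R)) sin_add2pin subrr => /eqP.
by rewrite !mulf_eq0 pnatr_eq0/= (gt_eqF al_gt0)/= => /eqP.
Qed.

Lemma sum_cos_nodes (R : realType) (M k : nat) (y : R) : (0 < k < M)%N ->
  \sum_(j < M) cos (k%:R * (y - 2 * pi * (j%:R / M%:R))) = 0.
Proof.
move=> kM; rewrite -[RHS](@sum_cos_equispaced R M k (k%:R * y))//.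
by apply: eq_bigr => j _; congr cos; ring.
Qed.

(** Two phases, because the two factors come from different evaluation
    points: the product-to-sum formula leaves the frequencies [k + l] and
    [k - l], neither of which is a multiple of [M]. *)
Lemma sum_cosM_nodes (R : realType) (M k l : nat) (y z : R) :
  (l < k)%N -> (k + l < M)%N ->
  \sum_(j < M) cos (k%:R * (y - 2 * pi * (j%:R / M%:R))) *
               cos (l%:R * (z - 2 * pi * (j%:R / M%:R))) = 0.
Proof.
move=> lk klM.
have E1 : \sum_(j < M) cos (k%:R * y + l%:R * z -
    2 * pi * (k + l)%:R * (j%:R / M%:R)) = 0 :> R.
  by rewrite sum_cos_equispaced// klM addn_gt0 (leq_ltn_trans _ lk).
have E2 : \sum_(j < M) cos (k%:R * y - l%:R * z -
    2 * pi * (k - l)%:R * (j%:R / M%:R)) = 0 :> R.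
  rewrite sum_cos_equispaced// subn_gt0 lk (leq_ltn_trans _ klM)//.
  by rewrite (leq_trans (leq_subr _ _))// leq_addr.
apply: (@mulfI R 2); first by rewrite pnatr_eq0.
rewrite mulr0 -[RHS]addr0 -[X in _ = X + _]E1 -[X in _ = _ + X]E2.
rewrite mulr_sumr -big_split/=; apply: eq_bigr => j _.
set t := j%:R / M%:R.
have -> : k%:R * y + l%:R * z - 2 * pi * (k + l)%:R * t =
  k%:R * (y - 2 * pi * t) + l%:R * (z - 2 * pi * t) by rewrite natrD; ring.
have -> : k%:R * y - l%:R * z - 2 * pi * (k - l)%:R * t =
  k%:R * (y - 2 * pi * t) - l%:R * (z - 2 * pi * t).
  by rewrite natrB ?(ltnW lk)//; ring.
by rewrite cosD cosB; ring.
Qed.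

(** The Fejer kernel has mean 1; the coefficients of positive frequency are
    doubled because the kernel is written with cosines only. *)
Definition fejer_coef (R : realType) (N k : nat) : R :=
  if k == 0%N then 1 else 2 * (1 - k%:R / N.+1%:R).

Definition fejer (R : realType) (N : nat) (x : R) : R :=
  \sum_(k < N.+1) fejer_coef R N k * cos (k%:R * x).

Lemma fejer_coef_gt0 (R : realType) N k : (k <= N)%N -> 0 < fejer_coef R N k.
Proof.
rewrite /fejer_coef; case: eqP => // _ kN.
by rewrite mulr_gt0// subr_gt0 ltr_pdivrMr ?ltr0n// mul1r ltr_nat.
Qed.

Lemma fejer_coef_le2 (R : realType) N k : fejer_coef R N k <= 2.
Proof.
rewrite /fejer_coef; case: eqP => // _; first by rewrite ler1n.
by rewrite ler_piMr// gerBl divr_ge0.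
Qed.

(** The kernel is, up to the factor [N + 1], the squared modulus of a geometric
    sum of exponentials, hence nonnegative. *)
Lemma fejer_square (R : realType) N (x : R) : N.+1%:R * fejer N x =
  (\sum_(k < N.+1) cos (k%:R * x)) ^+ 2 + (\sum_(k < N.+1) sin (k%:R * x)) ^+ 2.
Proof.
have step n : (\sum_(k < n.+1) cos (k%:R * x)) * cos (n.+1%:R * x) +
   (\sum_(k < n.+1) sin (k%:R * x)) * sin (n.+1%:R * x) =
   \sum_(k < n.+1) cos (k.+1%:R * x).
  rewrite !mulr_suml -big_split/=.
  rewrite [RHS](reindex_inj rev_ord_inj)/=; apply: eq_bigr => i _.
  have -> : (n.+1 - i.+1).+1%:R * x = n.+1%:R * x - i%:R * x.
    by rewrite -mulrBl -natrB ?(ltnW (ltn_ord i))// subSS subSn// -ltnS.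
  rewrite cosB; ring.
have fejE n : n.+1%:R * fejer n x =
    n.+1%:R + 2 * \sum_(k < n.+1) (n.+1%:R - k.+1%:R) * cos (k.+1%:R * x).
  rewrite /fejer big_ord_recl/= mul0r cos0 /fejer_coef/= mulr1 mulrDr mulr1.
  congr (_ + _); rewrite [in RHS]big_ord_recr/= subrr mul0r addr0 !mulr_sumr.
  apply: eq_bigr => i _; rewrite /bump/= add1n; field.
  by rewrite addrC natr1 pnatr_eq0.
rewrite fejE; elim: N => [|n IH].
  rewrite !big_ord1 !mul0r cos0 sin0 subrr mul0r; ring.
rewrite [in RHS]big_ord_recr/= [X in _ = _ + X ^+ 2]big_ord_recr/=.
set C := \sum_(k < n.+1) cos _ in IH step *.
set S := \sum_(k < n.+1) sin _ in IH step *.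
have -> : (C + cos (n.+1%:R * x)) ^+ 2 + (S + sin (n.+1%:R * x)) ^+ 2 =
  (C ^+ 2 + S ^+ 2) + 2 * (C * cos (n.+1%:R * x) + S * sin (n.+1%:R * x)) +
  (cos (n.+1%:R * x) ^+ 2 + sin (n.+1%:R * x) ^+ 2) by ring.
rewrite -IH cos2Dsin2 step big_ord_recr/= subrr mul0r addr0.
rewrite -[n.+2%:R]natr1 -!addrA; congr (_ + _).
rewrite addrA -mulrDr -big_split/= addrC; congr (_ + _).
by congr (2 * _); apply: eq_bigr => i _; ring.
Qed.

Lemma fejer_ge0 (R : realType) N (x : R) : 0 <= fejer N x.
Proof.
rewrite -(@pmulr_rge0 _ N.+1%:R) ?ltr0n// fejer_square.
by rewrite addr_ge0// sqr_ge0.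
Qed.

Lemma sum_fejer_nodes (R : realType) N M (y : R) : (N < M)%N ->
  \sum_(j < M) fejer N (y - 2 * pi * (j%:R / M%:R)) = M%:R.
Proof.
move=> NM; rewrite exchange_big/= big_ord_recl/= /fejer_coef/=.
under eq_bigr do rewrite mul0r cos0 mulr1.
rewrite sumr_const card_ord big1 ?addr0// => i _.
rewrite -mulr_sumr sum_cos_nodes ?mulr0// /bump/= add1n/=.
by rewrite (leq_ltn_trans _ NM).
Qed.

(** How concentrated the kernel is: the weight [1 - cos] measures the squared
    distance to the origin of the circle, and only the frequencies 0 and 1 of
    the kernel meet it. The average is therefore exactly [1 / (N + 1)], also
    when integrals are replaced by averages over the nodes. *)
Lemma sum_fejer_cos_nodes (R : realType) N M (y : R) : (N.+1 < M)%N ->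
  \sum_(j < M) fejer N (y - 2 * pi * (j%:R / M%:R)) *
    (1 - cos (y - 2 * pi * (j%:R / M%:R))) = M%:R / N.+1%:R.
Proof.
move=> NM.
have M1 : (1 < M)%N by apply: leq_ltn_trans NM.
transitivity (M%:R - \sum_(j < M) fejer N (y - 2 * pi * (j%:R / M%:R)) *
    cos (y - 2 * pi * (j%:R / M%:R))).
  rewrite -[X in _ = X - _](@sum_fejer_nodes R N M y) ?(ltnW NM)// -sumrB.
  by apply: eq_bigr => j _; rewrite mulrBr mulr1.
under eq_bigr do rewrite mulr_suml.
rewrite exchange_big/= big_ord_recl/=.
under eq_bigr do rewrite mul0r cos0 /fejer_coef/= !mul1r.
have -> : \sum_(j < M) cos (y - 2 * pi * (j%:R / M%:R)) = 0.
  rewrite -[RHS](@sum_cos_nodes R M 1 y)//.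
  by apply: eq_bigr => j _; rewrite mul1r.
rewrite add0r.
case: N NM => [|N] NM; first by rewrite big_ord0 subr0 divr1.
rewrite big_ord_recl/= [X in _ - (_ + X)]big1 => [|i _].
  under eq_bigr do rewrite /bump/= mul1r -mulrA.
  rewrite -mulr_sumr addr0 /fejer_coef/=.
  have -> : \sum_(j < M) cos (y - 2 * pi * (j%:R / M%:R)) *
    cos (y - 2 * pi * (j%:R / M%:R)) = M%:R / 2.
    transitivity (\sum_(j < M) (2^-1 + 2^-1 *
        cos (2%:R * (y - 2 * pi * (j%:R / M%:R))))).
      apply: eq_bigr => j _; set t := y - _.
      have -> : 2%:R * t = t *+ 2 by rewrite mulr_natl.
      by rewrite cos_mulr2n; set c := cos t; lra.
    rewrite big_split/= -mulr_sumr sum_cos_nodes ?(leq_trans _ NM)//.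
    by rewrite sumr_const card_ord mulr0 addr0 mulrC mulr_natr.
  by field; rewrite -natrD pnatr_eq0.
under eq_bigr do rewrite /bump/= !add1n -mulrA.
rewrite -mulr_sumr -[RHS](mulr0 (fejer_coef R N.+1 i.+2)); congr (_ * _).
rewrite -[RHS](@sum_cosM_nodes R M i.+2 1 y y) ?addn1//; last first.
  by rewrite (leq_trans _ NM)// !ltnS.
by apply: eq_bigr => j _; rewrite mul1r.
Qed.

(** * Critical points of discretised energies *)

(** One-sided on purpose: it is applied at boundary points, where only the
    inward half-line is available, and twice, in opposite directions, at
    critical points. *)
Lemma is_derive_min_right_ge0 (R : realType) (h : R -> R) (d r : R) :
  is_derive (0 : R) 1 h d -> 0 < r -> (forall t, 0 < t < r -> h 0 <= h t) ->
  0 <= d.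
Proof.
move=> [dh <-] r0 hr; rewrite /derive cvg_at_rightE//.
apply: limr_ge.
  have := dh; rewrite /derivable => dh'.
  rewrite -(cvg_at_rightE (fun u : R => u^-1 *: ((h \o shift 0) (u *: 1) - h 0))) //.
  apply: cvg_trans dh'; apply: cvg_app.
  move=> A [e egt0 Ae]; exists e => // x xe xgt0; apply: Ae => //.
  exact/lt0r_neq0.
near=> t; have t0 : 0 < t by near: t; exact: nbhs_right_gt.
rewrite mulr_ge0 ?invr_ge0 ?(ltW t0)// subr_ge0/= addr0 [_%:A]mulr1 hr// t0/=.
by near: t; exact: nbhs_right_lt.
Unshelve. all: by end_near. Qed.

Lemma is_derive_addf (R : realType) (f g : R -> R) (x a b : R) :
  is_derive x (1 : R) f a -> is_derive x (1 : R) g b ->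
  is_derive x (1 : R) (fun t => f t + g t) (a + b).
Proof. exact: is_deriveD. Qed.

Lemma is_derive_mulf (R : realType) (f g : R -> R) (x a b : R) :
  is_derive x (1 : R) f a -> is_derive x (1 : R) g b ->
  is_derive x (1 : R) (fun t => f t * g t) (a * g x + f x * b).
Proof.
move=> df dg; apply: (@is_derive_eq _ _ _ _ _ _ _ _ (is_deriveM df dg)).
by rewrite addrC mulrC.
Qed.

Lemma is_derive_scalef (R : realType) (k : R) (f : R -> R) (x a : R) :
  is_derive x (1 : R) f a -> is_derive x (1 : R) (fun t => k * f t) (k * a).
Proof. by move=> df; exact: (is_deriveZ k df). Qed.

Lemma is_derive_affine (R : realType) (a b x : R) :
  is_derive x (1 : R) (fun t => a + t * b) b.
Proof.
rewrite -[X in is_derive _ _ _ X]add0r; apply: is_derive_addf.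
under eq_fun do rewrite mulrC; rewrite -[X in is_derive _ _ _ X]mulr1.
by apply: is_derive_scalef; exact: is_derive_id.
Qed.

Lemma is_derive_bigsum (R : realType) m (h : 'I_m -> R -> R) (dh : 'I_m -> R)
  (x : R) : (forall i, is_derive x (1 : R) (h i) (dh i)) ->
  is_derive x (1 : R) (fun t => \sum_i h i t) (\sum_i dh i).
Proof.
move=> H; have -> : (fun t => \sum_i h i t) = \sum_i h i.
  by apply/funext => t; rewrite fct_sumE.
exact: is_derive_sum.
Qed.

Lemma continuous_addf (T : topologicalType) (R : realType) (f g : T -> R) :
  continuous f -> continuous g -> continuous (fun x => f x + g x).
Proof. by move=> cf cg x; exact: cvgD (cf x) (cg x). Qed.

Lemma continuous_mulf (T : topologicalType) (R : realType) (f g : T -> R) :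
  continuous f -> continuous g -> continuous (fun x => f x * g x).
Proof. by move=> cf cg x; exact: cvgM (cf x) (cg x). Qed.

Lemma continuous_cstf (T : topologicalType) (R : realType) (a : R) :
  continuous (fun _ : T => a).
Proof. by move=> x; exact: cvg_cst. Qed.

Lemma continuous_bigsum (T : topologicalType) (R : realType) m
  (h : 'I_m -> T -> R) : (forall i, continuous (h i)) ->
  continuous (fun x => \sum_i h i x).
Proof.
by move=> ch; apply: continuous_big => [|i _]; [exact: add_continuous|exact: ch].
Qed.

(** Direct method: the energy
    [1/2 sum_i kap_i c_i^2 + mean_j F (s_j + sum_k c_k E_kj)] is coercive since
    every [kap_i] is positive and [F] is bounded, so it has a minimiser, where
    all directional derivatives vanish. The last bound compares the minimum
    with the energy of [c = 0]. *)
Lemma galerkin_critical_point (R : realType) (m M : nat) (F f : R -> R) (B : R)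
  (kap : 'I_m -> R) (E : 'I_m -> 'I_M -> R) (s : 'I_M -> R) :
  (0 < M)%N -> (forall x : R, is_derive x (1 : R) F (f x)) ->
  (forall x, `|F x| <= B) -> (forall i, 0 < kap i) ->
  exists c : 'I_m -> R,
    (forall i, kap i * c i +
       M%:R^-1 * \sum_j f (s j + \sum_k c k * E k j) * E i j = 0) /\
    \sum_i kap i * c i ^+ 2 <= 4 * B.
Proof.
move=> M0 dF FB kap0.
have Mp : 0 < M%:R :> R by rewrite ltr0n.
have B0 : 0 <= B by apply: le_trans (FB 0).
have cF : continuous F.
  move=> x; apply: differentiable_continuous; apply/derivable1_diffP.
  by have [] := dF x.
pose J (c : 'I_m -> R) : R := 2^-1 * \sum_i kap i * c i ^+ 2 +
  M%:R^-1 * \sum_j F (s j + \sum_k c k * E k j).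
have avgF (y : 'I_M -> R) : `|M%:R^-1 * \sum_j F (y j)| <= B.
  rewrite normrM ger0_norm ?invr_ge0 ?(ltW Mp)// ler_pdivrMl//.
  apply: le_trans (ler_norm_sum _ _ _) _.
  apply: (@le_trans _ _ (\sum_(j < M) B)); first exact: ler_sum.
  by rewrite sumr_const card_ord mulr_natl.
(* Outside the box of half-width r one coordinate alone makes the energy
   exceed B, which bounds the energy of the origin. *)
pose r : R := 1 + \sum_i 4 * B / kap i.
have kr i : 4 * B <= kap i * r ^+ 2.
  have r1 : 1 <= r.
    by rewrite lerDl sumr_ge0// => k _; rewrite !mulr_ge0// invr_ge0 ltW.
  apply: (@le_trans _ _ (kap i * r)).
    rewrite -ler_pdivrMl// mulrC /r (bigD1 i)//=.
    rewrite addrA addrAC lerDr addr_ge0// sumr_ge0// => k _.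
    by rewrite !mulr_ge0// invr_ge0 ltW.
  by rewrite ler_pM2l// expr2 ler_peMr// (le_trans _ r1).
have r_ge0 : 0 <= r.
  by rewrite addr_ge0// sumr_ge0// => k _; rewrite !mulr_ge0// invr_ge0 ltW.
pose box := [set v : 'rV[R]_m | forall i, `[- r, r]%classic (v ord0 i)].
have box_compact : compact box.
  by apply: (@rV_compact _ _ (fun=> `[- r, r]%classic)) => i; exact: segment_compact.
pose Jv (v : 'rV[R]_m) := J (fun i => v ord0 i).
have cJ : continuous Jv.
  have cc i : continuous (fun v : 'rV[R]_m => v ord0 i).
    exact: coord_continuous.
  apply: continuous_addf; apply: continuous_mulf;
    try exact: continuous_cstf; apply: continuous_bigsum => i.
    apply: continuous_mulf; first exact: continuous_cstf.
    exact: continuous_mulf.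
  move=> v; apply: (@continuous_comp _ _ _
    (fun v : 'rV[R]_m => s i + \sum_k v ord0 k * E k i) F); last exact: cF.
  apply: continuous_addf; first exact: continuous_cstf.
  apply: continuous_bigsum => k; apply: continuous_mulf => //.
  exact: continuous_cstf.
have box0 : box 0 by move=> i /=; rewrite mxE in_itv/= oppr_le0 r_ge0.
have [] := @compact_EVT_min _ R Jv box _ box_compact.
- by exists 0.
- exact: continuous_subspaceT.
move=> v _ vmin.
pose c i := v ord0 i.
have J0 : J (fun=> 0) <= B.
  rewrite /J big1 ?mulr0 ?add0r => [|i _]; last by rewrite expr0n mulr0.
  exact: le_trans (ler_norm _) (avgF _).
have Jge (a : 'I_m -> R) : 2^-1 * (\sum_i kap i * a i ^+ 2) - B <= J a.
  by rewrite lerD2l lerNl; apply: le_trans (ler_norm _) _; rewrite normrN.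
have ksq (a : 'I_m -> R) i : 0 <= kap i * a i ^+ 2.
  by rewrite mulr_ge0 ?sqr_ge0// ltW.
have Jc0 : J c <= J (fun=> 0).
  have := vmin 0; rewrite inE => /(_ box0); rewrite /Jv.
  by under [X in _ <= J X]eq_fun do rewrite mxE.
have Jmin a : J c <= J a.
  have [ain|] := pselect (forall i, - r <= a i <= r).
    have -> : a = (fun i => (\row_i a i) ord0 i) by apply/funext => i; rewrite mxE.
    apply: (vmin (\row_i a i)); rewrite inE => i /=; rewrite mxE in_itv/=; exact: ain.
  move=> /existsNP[i /negP ai].
  apply: le_trans Jc0 (le_trans J0 (le_trans _ (Jge a))).
  rewrite lerBrDr -mulr2n -[B *+ 2]mulr_natl ler_pdivlMl// mulrA -natrM.
  apply: le_trans (kr i) _; rewrite (bigD1 i)//= ler_wpDr ?sumr_ge0//.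
  rewrite ler_pM2l// -[leRHS]real_normK ?num_real// ler_sqr ?nnegrE//.
  rewrite leNgt; apply/negP => /ltW; rewrite ler_norml; exact/negP.
exists c; split; last first.
  have := le_trans (Jge c) (le_trans Jc0 J0).
  by rewrite lerBlDr -mulr2n -[B *+ 2]mulr_natl ler_pdivrMl// mulrA -natrM.
move=> i; set D := _ + _.
(* The line c + t sg e_i, for sg = 1 and sg = - 1. *)
have key (sg : R) : 0 <= sg * D.
  pose h t := J (fun k => c k + t * (sg * (k == i)%:R)).
  apply: (@is_derive_min_right_ge0 R h (sg * D) 1) => //; last first.
    move=> t _; rewrite {1}/h.
    by under [X in J X <= _]eq_fun do rewrite mul0r addr0; exact: Jmin.
  rewrite /h /J.
  rewrite /D mulrDr; apply: is_derive_addf.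
    have -> : sg * (kap i * c i) =
        2^-1 * \sum_k kap k * (2 * c k * (sg * (k == i)%:R)).
      rewrite (bigD1 i)//= big1 ?addr0 => [|k /negbTE ->].
        by rewrite eqxx mulr1; field.
      by rewrite !mulr0.
    apply: is_derive_scalef; apply: is_derive_bigsum => k.
    apply: is_derive_scalef.
    have dl := is_derive_affine (c k) (sg * (k == i)%:R) 0.
    have := is_derive_mulf dl dl.
    rewrite mul0r addr0 => H.
    by apply: is_derive_eq H _; ring.
  rewrite mulrCA; apply: is_derive_scalef; rewrite mulr_sumr.
  apply: is_derive_bigsum => j.
  have -> : (fun t => F (s j + \sum_k (c k + t * (sg * (k == i)%:R)) * E k j))
    = F \o (fun t => (s j + \sum_k c k * E k j) + t * (sg * E i j)).
    apply/funext => t /=; rewrite -addrA; congr (F (_ + _)).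
    under eq_bigr do rewrite mulrDl.
    rewrite big_split/=; congr (_ + _).
    rewrite (bigD1 i)//= big1 ?addr0 => [|k /negbTE ->].
      by rewrite eqxx mulr1 mulrA.
    by rewrite !mulr0 mul0r.
  have dl := is_derive_affine (s j + \sum_k c k * E k j) (sg * E i j) 0.
  have := is_derive1_comp (dF _) dl.
  rewrite mul0r addr0 => H; apply: is_derive_eq H _; ring.
apply/eqP; rewrite eq_le; apply/andP; split.
  by have := key (-1); rewrite mulN1r oppr_ge0.
by have := key 1; rewrite mul1r.
Qed.

(** * Continuous periodic functions *)

Lemma periodic_int (R : realType) (f : R -> R) (x : R) (z : int) :
  periodic f 1 -> f (x + z%:~R) = f x.
Proof.
move=> fper; case: z => n; first exact: (periodicn fper n x).
rewrite NegzE mulrNz.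
by have := periodicn fper n.+1 (x - n.+1%:R); rewrite subrK => ->.
Qed.

Lemma periodic_bounded (R : realType) (f : R -> R) : continuous f ->
  periodic f 1 -> exists m M : R, is_min f m /\ is_max f M.
Proof.
move=> cf fper.
have red x : exists2 y, y \in `[0, 1]%R & f x = f y.
  have /andP[h1 h2] := floor_itv x.
  exists (x - (Num.floor x)%:~R).
    rewrite in_itv/= subr_ge0 h1 lerBlDl.
    by rewrite intrD mulr1z in h2; exact: ltW.
  by rewrite -mulrNz periodic_int.
have [a _ amin] := @EVT_min R f 0 1 ler01 (continuous_subspaceT cf).
have [b _ bmax] := @EVT_max R f 0 1 ler01 (continuous_subspaceT cf).
exists (f a), (f b); split; split; first by exists a.
- by move=> x; have [y /amin + ->] := red x.
- by exists b.
- by move=> x; have [y /bmax + ->] := red x.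
Qed.

Lemma periodic_norm_bound (R : realType) (f : R -> R) : continuous f ->
  periodic f 1 -> exists2 B : R, 0 < B & forall x, `|f x| <= B.
Proof.
move=> cf fper; have [m [M [[_ fm] [_ fM]]]] := periodic_bounded cf fper.
exists (`|m| + `|M| + 1) => [|x]; first by rewrite ltr_pwDr ?addr_ge0.
rewrite ler_norml; apply/andP; split.
  apply: le_trans (fm x); rewrite lerNl.
  by apply: le_trans (ler_norm _) _; rewrite normrN -addrA lerDl addr_ge0.
apply: le_trans (fM x) _; apply: le_trans (ler_norm _) _.
by rewrite -addrA addrCA lerDl addr_ge0.
Qed.

(** Compactness of one period, with the radius as the parameter that tends to
    zero in the covering property. *)
Lemma periodic_unif_continuous (R : realType) (f : R -> R) : continuous f ->
  periodic f 1 -> forall e : R, 0 < e ->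
  exists2 d : R, 0 < d & forall x y, `|x - y| < d -> `|f x - f y| <= e.
Proof.
move=> cf fper e e0.
have cov : near_covering `[(0 : R), 1].
  by apply/compact_near_coveringP; exact: segment_compact.
have [] := cov R ((0 : R)^'+)
  (fun d x => forall y, `|x - y| < d -> `|f x - f y| <= e).
  move=> x _.
  have /(_ (ball (f x) (e / 2))) := cf x.
  move=> /(_ (nbhsx_ballx _ _ (divr_gt0 e0 (ltr0n _ 2)))) /nbhs_ballP[r /= r0 rf].
  exists (ball x (r / 2), [set d | d < r / 2]).
    split => /=; first by apply: nbhsx_ballx; rewrite divr_gt0.
    by apply: nbhs_right_lt; rewrite divr_gt0.
  move=> [z d] /= [xz dr] y zy.
  have zf : ball (f x) (e / 2) (f z).
    by apply: rf; apply: le_ball xz; rewrite ler_pdivrMr// ler_peMr ?ler1n// ltW.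
  have yf : ball (f x) (e / 2) (f y).
    apply: rf; rewrite [r]splitr; apply: (ball_triangle xz).
    by rewrite /ball/= (lt_trans zy).
  rewrite [e]splitr; apply: ltW.
  rewrite -[_ - f y](subrKA (f x)) (le_lt_trans (ler_normD _ _))// ltrD//.
  by rewrite distrC.
move=> d0 /= d00 H.
exists (d0 / 2); first by rewrite divr_gt0.
move=> x y xy.
have /andP[h1 h2] := floor_itv x.
have hd : ball_ Num.norm (0 : R) d0 (d0 / 2).
  rewrite /= sub0r normrN ger0_norm; last by rewrite divr_ge0 // ltW.
  by rewrite ltr_pdivrMr// ltr_pMr// ltr1n.
have hx : `[(0 : R), 1]%classic (x - (Num.floor x)%:~R).
  rewrite /= in_itv/= subr_ge0 h1 lerBlDl.
  by rewrite intrD mulr1z in h2; exact: ltW.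
have := H (d0 / 2) hd (divr_gt0 d00 (ltr0n _ 2)) _ hx (y - (Num.floor x)%:~R).
by rewrite -!mulrNz !(periodic_int _ _ fper) opprD addrACA subrr addr0; apply.
Qed.

Lemma is_derive_continuous (R : realType) (f : R -> R) (x d : R) :
  is_derive x (1 : R) f d -> {for x, continuous f}.
Proof.
by move=> [df _]; apply: differentiable_continuous; exact/derivable1_diffP.
Qed.

(** The primitive based at -1 is differentiable to the right of -1 and
    1-periodic there because the mean vanishes; it is extended to the whole
    line by shifting the argument by a large integer. *)
Lemma periodic_antiderivative (R : realType) (f : R -> R) : continuous f ->
  periodic f 1 -> mean f = 0 -> exists F : R -> R, periodic F 1 /\
    forall x, is_derive x (1 : R) F (f x).
Proof.
move=> cf fper f0.
pose G x := (\int[lebesgue_measure]_(t in `[(-1 : R), x]) f t)%R.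
have dG (x : R) : -1 < x -> is_derive x (1 : R) G (f x).
  move=> x1.
  have [] := @continuous_FTC1_closed R f (-1) x (x + 1) _ _ x1 (cf x).
  - by rewrite ltrDl.
  - apply: continuous_compact_integrable; first exact: segment_compact.
    exact: continuous_subspaceT.
  by move=> dGx Gx; apply: DeriveDef => //; rewrite -derive1E.
have G01 : G 1 = G 0.
  have fG : (\int[lebesgue_measure]_(t in `[(0 : R)%R, 1%R]) (f t)%:E =
      (G 1%R)%:E - (G 0%R)%:E)%E.
    apply: continuous_FTC2 => //.
    - exact: continuous_subspaceT.
    - have cG (x : R) : -1 < x -> {for x, continuous G}.
        by move=> x1; exact: is_derive_continuous (dG x x1).
      split.
      + move=> x; rewrite in_itv/= => /andP[x0 _].
        by have [] := dG x (lt_trans (ltrN10 R) x0).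
      + by apply: cvg_at_right_filter; apply: cG; rewrite ltrN10.
      + by apply: cvg_at_left_filter; apply: cG; rewrite (lt_trans (ltrN10 R)).
    - move=> x; rewrite in_itv/= => /andP[x0 _].
      by rewrite derive1E; have [_ ->] := dG x (lt_trans (ltrN10 R) x0).
  move: f0; rewrite /mean /Rintegral fG -EFinB /= => /eqP.
  by rewrite subr_eq0 => /eqP.
have dH (x : R) : -1 < x -> is_derive x (1 : R) (fun x => G (x + 1) + (-1) * G x) 0.
  move=> x1.
  have -> : 0 = f (x + 1) * 1 + (-1) * f x by rewrite fper mulr1 mulN1r subrr.
  apply: is_derive_addf; last exact/is_derive_scalef/dG.
  have := is_derive_affine 1 1 x.
  under eq_fun do rewrite mulr1 addrC.
  by apply: (@is_derive1_comp R G (fun t => t + 1)); apply: dG; lra.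
have Gper1 (x : R) : -1 < x -> G (x + 1) = G x.
  move=> x1; apply/eqP; rewrite -subr_eq0 -mulN1r; apply/eqP.
  set H := fun x => G (x + 1) + (-1) * G x in dH *.
  have H0 : H 0 = 0 by rewrite /H add0r G01 mulN1r subrr.
  rewrite -[LHS]/(H x).
  have Hc y z : -1 < y -> y <= z -> H z = H y.
    move=> y1 yz.
    have gt1 w : w \in `[y, z]%R -> -1 < w.
      by rewrite in_itv/= => /andP[yw _]; exact: lt_le_trans yw.
    have [| |c _] := @MVT_segment R H (fun=> 0) y z yz.
    - move=> w wyz; apply: dH; apply: gt1; move: wyz.
      by rewrite !in_itv/= => /andP[/ltW -> /ltW ->].
    - apply: derivable_within_continuous => w /gt1 w1.
      by have [] := dH w w1.
    by move=> /eqP; rewrite mul0r subr_eq0 => /eqP.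
  have [x0|/ltW x0] := leP 0 x; first by rewrite (Hc 0 x) ?ltrN10.
  by rewrite -(Hc x 0).
have Gper (x : R) n : -1 < x -> G (x + n%:R) = G x.
  move=> x1; elim: n => [|n <-]; first by rewrite addr0.
  by rewrite -natr1 addrA Gper1// (lt_le_trans x1)// lerDl.
pose nb (x : R) := Num.bound x.
pose F x := G (x + (nb x)%:R).
have nbP x : -1 < x + (nb x)%:R.
  by have := unstable.ltrNbound x; rewrite -/(nb x); lra.
have FE (x : R) n : -1 < x + n%:R -> F x = G (x + n%:R).
  move=> xn; rewrite /F -(Gper _ n (nbP x)) -(Gper _ (nb x) xn).
  by rewrite -!addrA [n%:R + _]addrC.
exists F; split => x.
  rewrite (FE (x + 1) (nb x)); last by have := nbP x; lra.
  by rewrite addrAC Gper1.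
have := is_derive_affine (nb x)%:R 1 x.
under eq_fun do rewrite mulr1 addrC.
move=> dlin.
have H := @is_derive1_comp R G (fun t => t + (nb x)%:R) x _ _ (dG _ (nbP x)) dlin.
have -> : f x = f (x + (nb x)%:R) * 1.
  by rewrite mulr1 (periodic_int _ (Posz (nb x)) fper).
apply: near_eq_is_derive H; near=> y; rewrite /= (FE y (nb x))//.
rewrite -ltrBlDr; near: y; apply: lt_nbhsr.
by rewrite ltrBlDr.
Unshelve. all: by end_near. Qed.

(** * Increments of trigonometric polynomials *)

(** Each term is at most [4 / ((A + k) (A + k + 1))] with [A = 1 / y], since
    [min (1 / (k + 1), 1 / A) <= 2 / (A + k + 1)]; this telescopes. *)
Lemma sum_min_inv_sqr (R : realType) (N : nat) (y : R) : 0 < y ->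
  \sum_(k < N) Num.min (k.+1%:R^-1) y ^+ 2 <= 4 * y.
Proof.
move=> y0.
have tel : \sum_(k < N) Num.min (k.+1%:R^-1) y ^+ 2 <=
    4 * (y - (y^-1 + N%:R)^-1).
  elim: N => [|N IH]; first by rewrite big_ord0 addr0 invrK subrr mulr0.
  rewrite big_ord_recr/=; apply: le_trans (lerD IH (lexx _)) _.
  rewrite -lerBrDl -mulrBr opprD opprK addrACA subrr add0r.
  set A := y^-1; have A0 : 0 < A by rewrite invr_gt0.
  set b := Num.min _ _.
  have m0 : 0 < N.+1%:R :> R by rewrite ltr0n.
  have b0 : 0 <= b by rewrite le_min invr_ge0 !ltW.
  have AN : 0 < A + N%:R by rewrite ltr_pwDl.
  have AN1 : 0 < A + N.+1%:R by rewrite addr_gt0.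
  have bA : b * (A + N.+1%:R) <= 2.
    rewrite mulrDr -[2]/(1 + 1) lerD//.
      by rewrite ler_pdivrMr// mul1r ge_min lexx orbT.
    by rewrite -ler_pdivlMr// mul1r ge_min lexx.
  have -> : - (A + N.+1%:R)^-1 + (A + N%:R)^-1 =
      ((A + N%:R) * (A + N.+1%:R))^-1.
    by rewrite -natr1; field; rewrite natr1 !gt_eqF.
  have : b ^+ 2 * (A + N.+1%:R) ^+ 2 <= 4.
    rewrite -exprMn (_ : 4 = 2 ^+ 2); last by rewrite -natrX.
    by rewrite ler_pXn2r// nnegrE ?mulr_ge0// ltW.
  rewrite -ler_pdivlMr ?exprn_gt0// => /le_trans; apply.
  rewrite ler_pM2l// lef_pV2 ?posrE ?mulr_gt0 ?exprn_gt0//.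
  by rewrite expr2 ler_pM2r// lerD2l ler_nat.
apply: le_trans tel _; rewrite ler_pM2l// gerBl invr_ge0.
by rewrite addr_ge0// invr_ge0 ltW.
Qed.

Lemma norm_sin_le (R : realType) (x : R) : `|sin x| <= `|x|.
Proof.
wlog x0 : x / 0 <= x.
  move=> H; have [/H//|/ltW x0] := leP 0 x.
  by rewrite -normrN -sinN -[`|x|]normrN; apply: H; rewrite oppr_ge0.
have [|c _] := @MVT_segment R sin cos 0 x x0 (fun z _ => is_derive_sin z).
  exact/continuous_subspaceT/continuous_sin.
rewrite sin0 !subr0 => ->; rewrite normrM ler_piMl//; exact: cos_max.
Qed.

Lemma sqr_cosB_le (R : realType) (a b : R) :
  (cos a - cos b) ^+ 2 <= 4 * Num.min 1 (`|a - b| / 2) ^+ 2.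
Proof.
have -> : cos a - cos b = - 2 * sin ((a + b) / 2) * sin ((a - b) / 2).
  rewrite -{1}[a](_ : (a + b) / 2 + (a - b) / 2 = a); last by field.
  rewrite -{3}[b](_ : (a + b) / 2 - (a - b) / 2 = b); last by field.
  rewrite cosD cosB; ring.
rewrite !exprMn sqrrN -mulrA (_ : 2 ^+ 2 = 4); last by rewrite -natrX.
rewrite ler_pM2l// -[leRHS]mul1r ler_pM ?sqr_ge0//.
rewrite -[leLHS]real_normK ?num_real// ler_sqr ?nnegrE//.
rewrite le_min sin_max/=; apply: le_trans (norm_sin_le _) _.
by rewrite normrM [X in _ * X]ger0_norm.
Qed.

Lemma sum_sqr_orthogonal (R : realType) (n M : nat) (a : 'I_n -> R)
  (e : 'I_n -> 'I_M -> R) :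
  (forall k l : 'I_n, (k < l)%N -> \sum_j e k j * e l j = 0) ->
  \sum_j (\sum_k a k * e k j) ^+ 2 = \sum_k a k ^+ 2 * \sum_j e k j ^+ 2.
Proof.
move=> orth.
under eq_bigr do rewrite expr2 mulr_suml.
rewrite exchange_big/=; apply: eq_bigr => k _.
under eq_bigr do rewrite mulr_sumr.
rewrite exchange_big/= (bigD1 k)//= [X in _ + X]big1 ?addr0.
  by rewrite mulr_sumr; apply: eq_bigr => j _; rewrite !expr2; ring.
move=> l; rewrite neq_ltn => lk.
rewrite (_ : \sum_j _ = a k * a l * \sum_j e k j * e l j); last first.
  by rewrite mulr_sumr; apply: eq_bigr => j _; ring.
case/orP: lk => lk; last by rewrite orth// mulr0.
by under eq_bigr do rewrite mulrC; rewrite orth// mulr0.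
Qed.

(** Parseval on the nodes: below the aliasing threshold [2 N < M] the
    increments at distinct frequencies are orthogonal, whatever the two points
    [x] and [y]. *)
Lemma sum_sqr_trig_increment (R : realType) (N M : nat) (w : nat -> R)
  (x y : R) : (N + N < M)%N ->
  \sum_(j < M) (\sum_(k < N.+1) w k *
     (cos (k%:R * (x - 2 * pi * (j%:R / M%:R))) -
      cos (k%:R * (y - 2 * pi * (j%:R / M%:R))))) ^+ 2 <=
  M%:R * \sum_(k < N) w k.+1 ^+ 2 *
     (4 * Num.min 1 (k.+1%:R * (`|x - y| / 2)) ^+ 2).
Proof.
move=> NM.
rewrite (@sum_sqr_orthogonal R N.+1 M (fun k => w k) (fun k j =>
   cos (k%:R * (x - 2 * pi * (j%:R / M%:R))) -
      cos (k%:R * (y - 2 * pi * (j%:R / M%:R))))); last first.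
  move=> k l kl.
  have klM : (l + k < M)%N.
    by rewrite (leq_ltn_trans _ NM)// leq_add// -ltnS.
  transitivity (\sum_(j < M) (
      cos (l%:R * (x - 2 * pi * (j%:R / M%:R))) *
      cos (k%:R * (x - 2 * pi * (j%:R / M%:R))) +
      - (cos (l%:R * (y - 2 * pi * (j%:R / M%:R))) *
      cos (k%:R * (x - 2 * pi * (j%:R / M%:R)))) +
      (- (cos (l%:R * (x - 2 * pi * (j%:R / M%:R))) *
      cos (k%:R * (y - 2 * pi * (j%:R / M%:R)))) +
      cos (l%:R * (y - 2 * pi * (j%:R / M%:R))) *
      cos (k%:R * (y - 2 * pi * (j%:R / M%:R)))))).
    by apply: eq_bigr => j _; ring.
  rewrite !big_split/= !sumrN !sum_cosM_nodes//; ring.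
rewrite big_ord_recl/= [X in X + _](_ : _ = 0) ?add0r; last first.
  by rewrite big1 ?mulr0// => j _; rewrite !mul0r subrr expr0n.
rewrite mulr_sumr; apply: ler_sum => k _; rewrite mulrCA.
rewrite /bump/= add1n ler_wpM2l ?sqr_ge0//.
set mm := 4 * _.
rewrite (_ : M%:R * mm = \sum_(j < M) mm); last first.
  by rewrite sumr_const card_ord mulr_natl.
apply: ler_sum => j _; apply: le_trans (sqr_cosB_le _ _) _.
by rewrite -mulrBr opprB addrA subrK normrM ger0_norm// -mulrA.
Qed.

(** * Approximate planar correctors *)

(** The critical point of the discretised energy, read as a trigonometric
    polynomial [psi]. Weighting the mode [k] by [2 pi lam k / fejer_coef k]
    makes the normal derivative of the harmonic extension of [psi] an average of
    the nonlinearity against the Fejer kernel, and [psi] itself, up to a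
    constant, an average against a Green kernel. The mode 0 has no Dirichlet energy; the
    small weight [eps] restores coercivity, at the price of the error
    [eps * c0]. *)
Lemma galerkin_trig (R : realType) (f F : R -> R) (N M : nat)
    (lam eps B : R) :
  (forall x : R, is_derive x (1 : R) F (f x)) -> (forall x, `|F x| <= B) ->
  0 < lam -> 0 < eps -> (0 < M)%N ->
  exists m (c ph : 'I_m -> R) (k : 'I_m -> nat) (c0 : R),
    let psi s := \sum_i c i * cos ((k i)%:R * (2 * pi * s) + ph i) in
    let g (j : 'I_M) := f (j%:R / M%:R + psi (j%:R / M%:R)) in
    [/\ eps * c0 ^+ 2 <= 4 * B,
      forall s, psi s = c0 - M%:R^-1 * \sum_j g j *
        \sum_(l < N.+1) fejer_coef R N l / (2 * pi * lam * l%:R) *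
          cos (l%:R * (2 * pi * s - 2 * pi * (j%:R / M%:R))) &
      forall s, \sum_i - (2 * pi * lam * (k i)%:R) *
          (c i * cos ((k i)%:R * (2 * pi * s) + ph i)) =
        M%:R^-1 * \sum_j g j * fejer N (2 * pi * s - 2 * pi * (j%:R / M%:R)) +
        eps * c0].
Proof.
move=> dF FB lam0 eps0 M0.
(* The first N + 1 indices are cosines, the others sines: a sine is a cosine
   with phase - pi / 2. *)
pose m := (N.+1 + N.+1)%N.
pose fr (i : 'I_m) : nat := match fintype.split i with inl k => k | inr k => k end.
pose ph (i : 'I_m) : R := match fintype.split i with inl k => 0 | inr k => - (pi / 2) end.
pose e i (x : R) : R := cos ((fr i)%:R * x + ph i).
have pairE (G : nat -> R) x y : \sum_i G (fr i) * e i y * e i x =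
    \sum_(k < N.+1) G k * cos (k%:R * (x - y)).
  rewrite big_split_ord/= -big_split/=; apply: eq_bigr => k _.
  rewrite /e /fr /ph (unsplitK (inl k)) (unsplitK (inr k)) !addr0 !cosBpihalf.
  by rewrite mulrBr cosB; ring.
have frN i : (fr i <= N)%N by rewrite /fr; case: fintype.split => k; rewrite -ltnS.
pose om (l : nat) : R := 2 * pi * lam * l%:R.
pose q := fejer_coef R N.
have q0 i : 0 < q (fr i) by exact: fejer_coef_gt0.
pose kap i : R := if fr i == 0%N then eps else om (fr i) / q (fr i).
have om_gt0 l : (0 < l)%N -> 0 < om l.
  by move=> l0; rewrite !mulr_gt0 ?pi_gt0 ?ltr0n.
have kap0 i : 0 < kap i.
  by rewrite /kap; case: eqP => // /eqP; rewrite -lt0n => l0; rewrite divr_gt0 ?om_gt0.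
have [c [crit energy]] := @galerkin_critical_point R m M F f B kap
  (fun i j => e i (2 * pi * (j%:R / M%:R))) (fun j => j%:R / M%:R) M0 dF FB kap0.
pose i0 : 'I_m := lshift N.+1 ord0.
exists m, c, ph, fr, (c i0) => psi g.
pose avg i : R := M%:R^-1 * \sum_j g j * e i (2 * pi * (j%:R / M%:R)).
have {}crit i : avg i = - (kap i * c i).
  by apply/eqP; rewrite -addr_eq0 addrC; apply/eqP; exact: crit.
have fr0 i : i = i0 -> fr i = 0%N by move=> ->; rewrite /fr /i0 (unsplitK (inl ord0)).
have zeroE x : \sum_i (fr i == 0%N)%:R * c i * e i x = c i0.
  rewrite big_split_ord/= !big_ord_recl/= !big1/= => [|k _|k _].
  - rewrite /e /fr /ph (unsplitK (inl ord0)) (unsplitK (inr ord0))/=.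
    by rewrite !mul0r !addr0 add0r cosN cos_pihalf cos0; ring.
  - by rewrite /fr (unsplitK (inr (lift ord0 k))) !mul0r.
  - by rewrite /fr (unsplitK (inl (lift ord0 k))) !mul0r.
have avgE (G : nat -> R) x : \sum_i G (fr i) * avg i * e i x =
  M%:R^-1 * \sum_j g j * \sum_(l < N.+1) G l *
    cos (l%:R * (x - 2 * pi * (j%:R / M%:R))).
  under [in RHS]eq_bigr do rewrite -pairE mulr_sumr.
  rewrite exchange_big/= mulr_sumr; apply: eq_bigr => i _.
  rewrite /avg mulrCA -mulrA; congr (_ * _); rewrite mulr_sumr mulr_suml.
  by apply: eq_bigr => j _; ring.
split.
- apply: le_trans energy; rewrite (bigD1 i0)//= {1}/kap fr0// eqxx lerDl.
  by rewrite sumr_ge0// => i _; rewrite mulr_ge0 ?sqr_ge0// ltW.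
- move=> s; rewrite -(avgE (fun l => q l / om l)) -(zeroE (2 * pi * s)) -sumrB.
  apply: eq_bigr => i _; rewrite -/(e i (2 * pi * s)) -mulrBl; congr (_ * _).
  (* At frequency 0 the Green kernel has no term, as x / 0 = 0. *)
  rewrite crit /kap; case: eqP => [->|/eqP fri].
    by rewrite /om mulr0 invr0 mulr0 mul0r mul1r subr0.
  have qn0 : q (fr i) != 0 by rewrite gt_eqF.
  have on0 : om (fr i) != 0 by rewrite gt_eqF// om_gt0// lt0n.
  by rewrite -[false%:R]/(0 : R); field; rewrite qn0 on0.
- move=> s; rewrite -(avgE q) -(zeroE (2 * pi * s)) mulr_sumr -big_split/=.
  apply: eq_bigr => i _; rewrite -/(e i (2 * pi * s)) -/(om (fr i)).
  rewrite crit /kap; case: eqP => [->|/eqP fri].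
    by rewrite -[true%:R]/(1 : R) /om /q /fejer_coef/=; ring.
  have qn0 : q (fr i) != 0 by rewrite gt_eqF.
  by rewrite -[false%:R]/(0 : R); field.
Qed.

Lemma cos2piB_le (R : realType) (h t : R) : 0 <= h -> h <= `|t| -> `|t| <= 2^-1 ->
  cos (2 * pi * t) <= cos (2 * pi * h).
Proof.
move=> h0 ht t2.
have pi2 : 0 < 2 * pi :> R by rewrite mulr_gt0 ?pi_gt0.
rewrite -cos_norm normrM (ger0_norm (ltW pi2)).
have hp u : 0 <= u -> u <= 2^-1 -> 2 * pi * u \in `[0, (pi : R)]%R.
  move=> u0 u2; rewrite in_itv/= mulr_ge0 ?(ltW pi2)//=.
  by apply: le_trans (ler_wpM2l (ltW pi2) u2) _; rewrite mulrAC divff// mul1r.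
rewrite leNgt ltr_cos ?hp// ?(le_trans ht)//; first by rewrite ltr_pM2l// -leNgt.
Qed.

Lemma cos2pi_lt1 (R : realType) (h : R) : 0 < h -> h < 2^-1 ->
  0 < 1 - cos (2 * pi * h).
Proof.
move=> h0 h2; have h2pi : 0 < 2 * pi * h by rewrite !mulr_gt0 ?pi_gt0.
have hin : 2 * pi * h \in `[0, (pi : R)]%R.
  rewrite in_itv/= (ltW h2pi)/= mulrAC -[leRHS]mul1r.
  by rewrite ler_wpM2r ?pi_ge0//; lra.
by rewrite subr_gt0 -[ltRHS]cos0 ltr_cos// in_itv/= lexx pi_ge0.
Qed.

(** Korovkin's argument: [|G t - G s|] is at most
    [eta + const * (1 - cos (2 pi (s - t)))], by the modulus of continuity near
    [s] and by boundedness away from it; averaging against the kernel, the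
    second part costs [const / (N + 1)]. *)
Lemma fejer_approximation (R : realType) (G : R -> R) (N M : nat)
    (B h eta : R) :
  periodic G 1 -> (forall s, `|G s| <= B) -> 0 < h -> h < 2^-1 -> 0 <= eta ->
  (forall s t, `|s - t| <= h -> `|G s - G t| <= eta) -> (N.+1 < M)%N ->
  forall s, `|M%:R^-1 * (\sum_(j < M) G (j%:R / M%:R) *
      fejer N (2 * pi * s - 2 * pi * (j%:R / M%:R))) - G s| <=
    eta + 2 * B / (1 - cos (2 * pi * h)) / N.+1%:R.
Proof.
move=> Gper GB h0 h2 eta0 Gh NM s.
have M0 : 0 < M%:R :> R by rewrite ltr0n (leq_ltn_trans _ NM).
have Mn0 : M%:R != 0 :> R by rewrite gt_eqF.
have B0 : 0 <= B by exact: le_trans (GB 0).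
have gam0 := cos2pi_lt1 h0 h2.
set gam := 1 - _ in gam0 *.
have pt t : `|G t - G s| <= eta + 2 * B / gam * (1 - cos (2 * pi * s - 2 * pi * t)).
  (* Move t by an integer to within distance 1/2 of s. *)
  pose z := Num.floor (s - t + 2^-1).
  have /andP[z1 z2] := floor_itv (s - t + 2^-1).
  rewrite -/z intrD mulr1z in z1 z2.
  pose th := s - (t + z%:~R).
  have -> : G t = G (t + z%:~R) by rewrite periodic_int.
  have -> : cos (2 * pi * s - 2 * pi * t) = cos (2 * pi * th).
    have -> : 2 * pi * s - 2 * pi * t = 2 * pi * th + 2 * pi * z%:~R by rewrite /th; ring.
    have per : periodic (fun u : R => cos (2 * pi * u)) 1.
      by move=> u; rewrite mulrDr mulr1 (_ : 2 * pi = pi *+ 2) ?cosD2pi// mulr_natl.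
    by have := periodic_int th z per; rewrite /= mulrDr.
  have thle : `|th| <= 2^-1 by rewrite ler_norml /th; apply/andP; split; lra.
  have [thh|/ltW hth] := leP `|th| h.
    apply: le_trans (Gh _ _ _) _; first by rewrite distrC.
    rewrite lerDl mulr_ge0// ?subr_ge0 ?cos_le1//.
    by rewrite divr_ge0 ?mulr_ge0// ltW.
  apply: (@le_trans _ _ (2 * B / gam * gam)).
    rewrite divfK ?gt_eqF// mulr_natl mulr2n.
    by apply: le_trans (ler_normB _ _) _; apply: lerD; exact: GB.
  apply: ler_wpDl => //; apply: ler_wpM2l.
    by rewrite divr_ge0 ?mulr_ge0// ltW.
  by rewrite lerD2l lerN2 cos2piB_le// ltW.
have fge (j : 'I_M) := fejer_ge0 N (2 * pi * s - 2 * pi * (j%:R / M%:R)).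
rewrite -[X in _ - X](mulKf Mn0) -mulrBr normrM ger0_norm ?invr_ge0 ?(ltW M0)//.
rewrite ler_pdivrMl// -[in X in _ - X](@sum_fejer_nodes R N M (2 * pi * s)) ?(ltnW NM)//.
rewrite mulr_suml -sumrB; apply: le_trans (ler_norm_sum _ _ _) _.
apply: (@le_trans _ _ (\sum_(j < M) (eta * fejer N (2 * pi * s - 2 * pi * (j%:R / M%:R)) +
   2 * B / gam * (fejer N (2 * pi * s - 2 * pi * (j%:R / M%:R)) *
    (1 - cos (2 * pi * s - 2 * pi * (j%:R / M%:R))))))).
  apply: ler_sum => j _; rewrite mulrC -mulrBr normrM (ger0_norm (fge j)).
  rewrite [leRHS](_ : _ = fejer N (2 * pi * s - 2 * pi * (j%:R / M%:R)) *
    (eta + 2 * B / gam * (1 - cos (2 * pi * s - 2 * pi * (j%:R / M%:R))))); last by ring.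
  by apply: ler_wpM2l; [exact: fge | exact: pt].
rewrite big_split/= -!mulr_sumr sum_fejer_nodes ?(ltnW NM)// sum_fejer_cos_nodes//.
by rewrite [leLHS](_ : _ = M%:R * (eta + 2 * B / gam / N.+1%:R))//; ring.
Qed.

(** A Hoelder-1/2 modulus that depends on neither [N] nor [M]: Young's
    inequality with the free weight [a], followed by Parseval for the Green
    kernel, whose coefficients decay like [1 / l]. Uniformity in [N] is what
    allows the degree to be chosen after the modulus. *)
Lemma galerkin_modulus (R : realType) (N M : nat) (lam B a x y : R)
    (g : 'I_M -> R) : 0 < lam -> (N + N < M)%N -> (forall j, `|g j| <= B) ->
  0 < a -> x != y ->
  forall W : R -> R, (forall s, W s = M%:R^-1 * \sum_j g j *
        \sum_(l < N.+1) fejer_coef R N l / (2 * pi * lam * l%:R) *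
          cos (l%:R * (2 * pi * s - 2 * pi * (j%:R / M%:R)))) ->
  `|W x - W y| <= B * (8 / (pi * lam ^+ 2) * `|x - y| / a + a).
Proof.
move=> lam0 NM gB a0 xy W WE.
have M0 : 0 < M%:R :> R by rewrite ltr0n (leq_ltn_trans _ NM).
have pi0 := @pi_gt0 R.
have pin0 : pi != 0 :> R by rewrite gt_eqF.
pose w (l : nat) : R := fejer_coef R N l / (2 * pi * lam * l%:R).
pose D (j : 'I_M) := \sum_(l < N.+1) w l *
  (cos (l%:R * (2 * pi * x - 2 * pi * (j%:R / M%:R))) -
   cos (l%:R * (2 * pi * y - 2 * pi * (j%:R / M%:R)))).
have -> : W x - W y = M%:R^-1 * \sum_j g j * D j.
  rewrite !WE -mulrBr -sumrB; congr (_ * _); apply: eq_bigr => j _.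
  by rewrite -mulrBr -sumrB; congr (_ * _); apply: eq_bigr => l _; rewrite [RHS]mulrBr.
rewrite normrM ger0_norm ?invr_ge0 ?(ltW M0)// ler_pdivrMl//.
have B0 : 0 <= B by apply: le_trans (gB (Ordinal (leq_ltn_trans (leq0n _) NM))).
have xy0 : 0 < `|x - y| by rewrite normr_gt0 subr_eq0.
have D2 : \sum_j D j ^+ 2 <= M%:R * (16 / (pi * lam ^+ 2) * `|x - y|).
  apply: le_trans (sum_sqr_trig_increment w (2 * pi * x) (2 * pi * y) NM) _.
  rewrite ler_pM2l//.
  have y0 : 0 < pi * `|x - y| by rewrite mulr_gt0.
  have ll : 0 < 4 / (pi * lam) ^+ 2 by rewrite divr_gt0// exprn_gt0// mulr_gt0.
  have cE : 4 / (pi * lam) ^+ 2 * (4 * (pi * `|x - y|)) =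
      16 / (pi * lam ^+ 2) * `|x - y|.
    have aux (P L X : R) : P != 0 -> L != 0 ->
        4 / (P * L) ^+ 2 * (4 * (P * X)) = 16 / (P * L ^+ 2) * X.
      by move=> P0 L0; field; rewrite P0 L0.
    by apply: aux => //; rewrite gt_eqF.
  have := sum_min_inv_sqr N y0; move/(ler_wpM2l (ltW ll)); rewrite cE.
  apply: le_trans; rewrite mulr_sumr; apply: ler_sum => l _.
  have l0 : 0 < l.+1%:R :> R by rewrite ltr0n.
  have -> : `|2 * pi * x - 2 * pi * y| / 2 = pi * `|x - y|.
    rewrite -mulrBr normrM ger0_norm ?mulr_ge0 ?(ltW pi0)//.
    have aux (P X : R) : 2 * P * X / 2 = P * X by field.
    exact: aux.
  set Y := pi * _ in y0 *.
  have -> : Num.min l.+1%:R^-1 Y = l.+1%:R^-1 * Num.min 1 (l.+1%:R * Y).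
    by rewrite minr_pMr ?invr_ge0 ?ler0n// mulr1 mulKf// gt_eqF.
  have wl : w l.+1 ^+ 2 <= (l.+1%:R * (pi * lam))^-1 ^+ 2.
    have q2 := fejer_coef_le2 R N l.+1.
    rewrite ler_pXn2r// ?nnegrE.
    - rewrite /w ler_pdivrMr ?mulr_gt0//.
      have aux (P L X : R) : P != 0 -> L != 0 -> X != 0 ->
          (X * (P * L))^-1 * (2 * P * L * X) = 2.
        by move=> P0 L0 X0; field; rewrite P0 L0 X0.
      by rewrite aux ?gt_eqF.
    - rewrite /w divr_ge0 ?(ltW (fejer_coef_gt0 R (ltn_ord l)))//.
      by rewrite !mulr_ge0// ltW.
    - by rewrite invr_ge0 !mulr_ge0 ?(ltW pi0) ?(ltW lam0).
  apply: le_trans (ler_wpM2r _ wl) _; first by rewrite mulr_ge0 ?sqr_ge0.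
  set mm := Num.min _ _.
  have aux (P L X : R) : P != 0 -> L != 0 -> X != 0 ->
      (X * (P * L))^-1 ^+ 2 * (4 * mm ^+ 2) = 4 / (P * L) ^+ 2 * (X^-1 * mm) ^+ 2.
    by move=> P0 L0 X0; field; rewrite P0 L0 X0.
  by rewrite aux ?gt_eqF.
apply: le_trans (ler_norm_sum _ _ _) _.
apply: (@le_trans _ _ (\sum_j B * (a^-1 / 2 * D j ^+ 2 + a / 2))).
  apply: ler_sum => j _; rewrite normrM; apply: ler_pM => //.
  have -> : a^-1 / 2 * D j ^+ 2 + a / 2 = `|D j| + (`|D j| - a) ^+ 2 / (2 * a).
    by rewrite -[D j ^+ 2]real_normK ?num_real//; field; rewrite gt_eqF.
  by rewrite lerDl divr_ge0 ?sqr_ge0// mulr_ge0// ltW.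
rewrite -mulr_sumr mulrCA ler_wpM2l// big_split/= -mulr_sumr sumr_const card_ord.
rewrite mulrDr lerD//.
  apply: le_trans (ler_wpM2l _ D2) _; first by rewrite divr_ge0 ?invr_ge0// ltW.
  set X := `|x - y|.
  have aux (P L : R) : P != 0 -> L != 0 ->
      a^-1 / 2 * (M%:R * (16 / (P * L ^+ 2) * X)) = M%:R * (8 / (P * L ^+ 2) * X / a).
    by move=> P0 L0; field; rewrite P0 L0 gt_eqF.
  by rewrite aux ?gt_eqF.
by rewrite -[leLHS]mulr_natl ler_wpM2l//; lra.
Qed.

(** The first sum is the normal derivative of the bounded harmonic extension of
    [psi (p . x')] to a half-space, with [lam] the norm of [p]. The error is
    kept, rather than sent to zero, because a trigonometric polynomial extends
    to a smooth test function and its error is absorbed by a tilt. The order of choices: the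
    modulus [d] of [f], then the scale [h] at which [s + psi s] moves by less
    than [d] for every [N], then [eps] and [N]. *)
Theorem approximate_corrector (R : realType) (f F : R -> R) (lam dl : R) :
  continuous f -> periodic f 1 -> periodic F 1 ->
  (forall x : R, is_derive x (1 : R) F (f x)) -> 0 < lam -> 0 < dl ->
  exists m (c ph : 'I_m -> R) (k : 'I_m -> nat), forall s : R,
    `|\sum_i - (2 * pi * lam * (k i)%:R) *
          (c i * cos ((k i)%:R * (2 * pi * s) + ph i)) -
      f (s + \sum_i c i * cos ((k i)%:R * (2 * pi * s) + ph i))| <= dl.
Proof.
move=> cf fper Fper dF lam0 dl0.
have cF : continuous F by move=> x; exact: is_derive_continuous (dF x).
have [B B0 fB] := periodic_norm_bound cf fper.
have [BF BF0 FB] := periodic_norm_bound cF Fper.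
have dl3 : 0 < dl / 3 by rewrite divr_gt0.
have [d d0 fd] := periodic_unif_continuous cf fper dl3.
pose C : R := 8 / (pi * lam ^+ 2).
have C0 : 0 < C by rewrite divr_gt0// mulr_gt0 ?pi_gt0// exprn_gt0.
pose a : R := d / (4 * B).
have a0 : 0 < a by rewrite divr_gt0// mulr_gt0.
pose h : R := Num.min 4^-1 (Num.min (d / 4) (a * d / (4 * B * C))).
have h0 : 0 < h.
  have BC0 : 0 < 4 * B * C by rewrite (mulr_gt0 _ C0)// mulr_gt0.
  rewrite !lt_min; apply/and3P; split; last exact: divr_gt0 (mulr_gt0 a0 d0) BC0.
    by rewrite invr_gt0 ltr0n.
  by rewrite divr_gt0.
have h4 : h <= 4^-1 by rewrite ge_min lexx.
have hd : h <= d / 4 by rewrite !ge_min lexx orbT.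
have ha : h <= a * d / (4 * B * C) by rewrite !ge_min lexx !orbT.
have h2 : h < 2^-1 by apply: le_lt_trans h4 _; lra.
have gam0 := cos2pi_lt1 h0 h2.
pose eps : R := (dl / 3) ^+ 2 / (4 * BF).
have eps0 : 0 < eps by rewrite divr_gt0 ?exprn_gt0// mulr_gt0.
pose Nr : R := 2 * B / (1 - cos (2 * pi * h)) / (dl / 3).
pose N := Num.bound Nr.
have NP : 2 * B / (1 - cos (2 * pi * h)) / N.+1%:R <= dl / 3.
  rewrite ler_pdivrMr ?ltr0n// [leRHS]mulrC -ler_pdivrMr//.
  apply: le_trans (ltW (unstable.ltr_bound _)) _.
  by rewrite ler_nat leqnSn.
pose M := (N + N).+2.
have NM : (N.+1 < M)%N by rewrite !ltnS leq_addr.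
have NNM : (N + N < M)%N by rewrite ltnS.
have [m [c [ph [k [c0 /= [c0E psiE lamE]]]]]] :=
  @galerkin_trig R f F N M lam eps BF dF FB lam0 eps0 isT.
exists m, c, ph, k => s.
set psi := fun s : R => \sum_i c i * cos ((k i)%:R * (2 * pi * s) + ph i) in psiE lamE *.
rewrite -/(psi s).
pose G t := f (t + psi t).
have Gper : periodic G 1.
  move=> t; rewrite /G -addrA [1 + _]addrC addrA fper; congr (f (_ + _)).
  apply: eq_bigr => i _; congr (_ * _).
  rewrite -(cos_add2pin (_ * (2 * pi * t) + ph i) (k i)); congr cos; ring.
have psi_mod x y : `|x - y| <= h -> `|psi x - psi y| <= d / 2.
  have [->|xy] := eqVneq x y; first by move=> _; rewrite subrr normr0 divr_ge0// ltW.
  move=> xyh.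
  have gB (j : 'I_M) : `|f (j%:R / M%:R + psi (j%:R / M%:R))| <= B by exact: fB.
  have WE (t : R) : c0 - psi t = M%:R^-1 * \sum_(j < M) f (j%:R / M%:R + psi (j%:R / M%:R)) *
        \sum_(l < N.+1) fejer_coef R N l / (2 * pi * lam * l%:R) *
          cos (l%:R * (2 * pi * t - 2 * pi * (j%:R / M%:R))).
    by rewrite [psi t]psiE opprB addrC subrK.
  have := galerkin_modulus lam0 NNM gB a0 xy WE.
  have -> : c0 - psi x - (c0 - psi y) = - (psi x - psi y) by ring.
  rewrite normrN -/C => /le_trans; apply.
  rewrite mulrDr [X in _ + X <= _](_ : _ = d / 4); last by rewrite /a; field; rewrite gt_eqF.
  have : B * (C * `|x - y| / a) <= d / 4.
    apply: (@le_trans _ _ (B * (C * (a * d / (4 * B * C)) / a))).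
      rewrite ler_pM2l// ler_pM2r ?invr_gt0// ler_pM2l//.
      exact: le_trans xyh ha.
    by rewrite [leLHS](_ : _ = d / 4)//; field; rewrite !gt_eqF.
  lra.
have Gmod x y : `|x - y| <= h -> `|G x - G y| <= dl / 3.
  move=> xyh; apply: fd; rewrite opprD addrACA.
  apply: le_lt_trans (ler_normD _ _) _.
  have := psi_mod _ _ xyh; lra.
have := @fejer_approximation R G N M B h (dl / 3) Gper (fun t => fB _) h0 h2
  (ltW dl3) Gmod NM s.
rewrite lamE -/(G s).
set S := M%:R^-1 * _ => HS.
have ec : `|eps * c0| <= dl / 3.
  rewrite -ler_sqr ?nnegrE ?(ltW dl3)// real_normK ?num_real//.
  rewrite exprMn expr2 -mulrA; apply: le_trans (ler_wpM2l (ltW eps0) c0E) _.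
  by rewrite /eps divfK// gt_eqF// mulr_gt0.
rewrite addrAC; apply: le_trans (ler_normD _ _) _.
have := le_trans HS (lerD (lexx _) NP); lra.
Qed.

(** * Smooth functions on the half-space *)

Section halfspace_calculus.
Context {R : realType} {n : nat}.
Implicit Types (x y : 'rV[R]_n.+1) (phi psi : 'rV[R]_n.+1 -> R).

Notation unit_vec i := (delta_mx ord0 i : 'rV[R]_n.+1).

Lemma is_derive_line phi (i : 'I_n.+1) x (t : R) :
  derivable phi (t *: unit_vec i + x) (unit_vec i) ->
  is_derive t (1 : R) (fun u => phi (u *: unit_vec i + x))
    (partial i phi (t *: unit_vec i + x)).
Proof.
move=> dphi.
have E : (fun h : R => h^-1 *: (((fun u => phi (u *: unit_vec i + x)) \o shift t) (h *: 1)
      - phi (t *: unit_vec i + x))) =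
    (fun h : R => h^-1 *: ((phi \o shift (t *: unit_vec i + x)) (h *: unit_vec i)
      - phi (t *: unit_vec i + x))).
  apply/funext => h /=; congr (_ *: (phi _ - _)).
  by rewrite [h%:A]mulr1 scalerDl addrA.
by apply: DeriveDef; rewrite /derivable /derive E.
Qed.

Lemma partial_eq phi (i : 'I_n.+1) (dphi : 'rV[R]_n.+1 -> R) :
  (forall x, is_derive (0 : R) (1 : R) (fun u => phi (u *: unit_vec i + x))
     (dphi x)) ->
  (forall x, derivable phi x (unit_vec i)) /\ partial i phi = dphi.
Proof.
move=> H; have E x : (fun h : R =>
     h^-1 *: (((fun u => phi (u *: unit_vec i + x)) \o shift 0) (h *: 1)
      - phi (0 *: unit_vec i + x))) =
    (fun h : R => h^-1 *: ((phi \o shift x) (h *: unit_vec i) - phi x)).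
  apply/funext => h /=.
  by rewrite [h%:A]mulr1 addr0 scale0r add0r.
split => [x|].
  by have [] := H x; rewrite /derivable E.
apply/funext => x; have [_ <-] := H x.
by rewrite /partial /derive E.
Qed.

Lemma smooth_continuous phi : smooth phi -> continuous phi.
Proof. by move=> /(_ 0%N) []. Qed.

Lemma smooth_derivable phi i x : smooth phi -> derivable phi x (unit_vec i).
Proof. by move=> /(_ 1%N) [_ /(_ i) [+ _]]; exact. Qed.

Lemma smooth_partial phi i : smooth phi -> smooth (partial i phi).
Proof. by move=> sphi k; have [_ /(_ i) []] := sphi k.+1. Qed.

Lemma smoothS phi : continuous phi ->
  (forall i x, derivable phi x (unit_vec i)) ->
  (forall i, smooth (partial i phi)) -> smooth phi.
Proof. by move=> cphi dphi sphi [|k] //=; split => // i; split => //; exact: sphi. Qed.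

Lemma partialD phi psi i : (forall x, derivable phi x (unit_vec i)) ->
  (forall x, derivable psi x (unit_vec i)) ->
  (forall x, derivable (fun x => phi x + psi x) x (unit_vec i)) /\
  partial i (fun x => phi x + psi x) = (fun x => partial i phi x + partial i psi x).
Proof.
move=> dphi dpsi; split => [x|]; first exact: derivableD.
by apply/funext => x; exact: deriveD.
Qed.

Lemma partialZ (a : R) phi i : (forall x, derivable phi x (unit_vec i)) ->
  (forall x, derivable (fun x => a * phi x) x (unit_vec i)) /\
  partial i (fun x => a * phi x) = (fun x => a * partial i phi x).
Proof.
move=> dphi; split => [x|]; first exact: (@derivableZ _ _ _ _ a _ _ (dphi x)).
by apply/funext => x; exact: (deriveZ a (dphi x)).
Qed.

Lemma CkD k phi psi : Ck k phi -> Ck k psi -> Ck k (fun x => phi x + psi x).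
Proof.
elim: k phi psi => [|k IH] phi psi [cphi Hphi] [cpsi Hpsi];
  split; try exact: continuous_addf; first by [].
move=> i; have [dphi kphi] := Hphi i; have [dpsi kpsi] := Hpsi i.
have [? ->] := partialD dphi dpsi.
by split => //; exact: IH.
Qed.

Lemma CkZ k (a : R) phi : Ck k phi -> Ck k (fun x => a * phi x).
Proof.
elim: k phi => [|k IH] phi [cphi Hphi];
  split; try (by apply: continuous_mulf => //; exact: continuous_cstf); first by [].
move=> i; have [dphi kphi] := Hphi i; have [? ->] := partialZ a dphi.
by split => //; exact: IH.
Qed.

(** What the viscosity conditions see of a smooth test function, packaged so
    that it can be computed along sums. *)
Definition jet phi (dn lap : 'rV[R]_n.+1 -> R) :=
  [/\ smooth phi, partial ord0 phi = dn & laplacian phi = lap].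

Lemma jetD phi dn lap psi dn' lap' : jet phi dn lap -> jet psi dn' lap' ->
  jet (fun x => phi x + psi x) (fun x => dn x + dn' x)
    (fun x => lap x + lap' x).
Proof.
move=> [sphi <- <-] [spsi <- <-].
have P i : partial i (fun x => phi x + psi x) =
    (fun x => partial i phi x + partial i psi x).
  by apply: (partialD _ _).2 => x; exact: smooth_derivable.
split; [by move=> k; exact: CkD | exact: P |].
apply/funext => x; rewrite /laplacian -big_split/=; apply: eq_bigr => i _.
rewrite P (partialD _ _).2// => {}x;
  by apply: smooth_derivable; exact: smooth_partial.
Qed.

Lemma jetZ (a : R) phi dn lap : jet phi dn lap ->
  jet (fun x => a * phi x) (fun x => a * dn x) (fun x => a * lap x).
Proof.
move=> [sphi <- <-].
have P i : partial i (fun x => a * phi x) = (fun x => a * partial i phi x).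
  by apply: (partialZ a _).2 => x; exact: smooth_derivable.
split; [by move=> k; exact: CkZ | exact: P |].
apply/funext => x; rewrite /laplacian mulr_sumr; apply: eq_bigr => i _.
rewrite P (partialZ a _).2// => {}x.
by apply: smooth_derivable; exact: smooth_partial.
Qed.

Lemma partial_cst (a : R) i :
  (forall x, derivable (fun _ : 'rV[R]_n.+1 => a) x (unit_vec i)) /\
  partial i (fun _ => a) = (fun _ => 0).
Proof. by apply: partial_eq => x; exact: is_derive_cst. Qed.

Lemma smooth_cst (a : R) : smooth (fun _ : 'rV[R]_n.+1 => a).
Proof.
move=> k; elim: k a => [|k IH] a; split; try exact: continuous_cstf; first by [].
by move=> i; have [? ->] := partial_cst a i; split.
Qed.

Lemma jet_cst (a : R) : jet (fun _ => a) (fun _ => 0) (fun _ => 0).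
Proof.
split; [exact: smooth_cst | exact: (partial_cst a ord0).2 |].
apply/funext => x; rewrite /laplacian big1// => i _.
by rewrite (partial_cst a i).2 (partial_cst 0 i).2.
Qed.

Lemma jet_sum m (phi dn lap : 'I_m -> 'rV[R]_n.+1 -> R) :
  (forall i, jet (phi i) (dn i) (lap i)) ->
  jet (fun x => \sum_i phi i x) (fun x => \sum_i dn i x)
    (fun x => \sum_i lap i x).
Proof.
elim: m phi dn lap => [|m IH] phi dn lap H.
  have E (g : 'I_0 -> 'rV[R]_n.+1 -> R) : (fun x => \sum_i g i x) = (fun _ => 0).
    by apply/funext => x; rewrite big_ord0.
  by rewrite !E; exact: jet_cst.
have E (g : 'I_m.+1 -> 'rV[R]_n.+1 -> R) : (fun x => \sum_i g i x) =
    (fun x => g ord0 x + \sum_i g (lift ord0 i) x).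
  by apply/funext => x; rewrite big_ord_recl.
rewrite !E; apply: jetD; first exact: H.
by apply: (IH (fun i => phi (lift ord0 i))) => i; exact: H.
Qed.

Lemma slopeD (mu : R) (p : 'rV[R]_n) x y :
  slope mu p (x + y) = slope mu p x + slope mu p y.
Proof.
rewrite /slope mxE mulrDr -!addrA; congr (_ + _).
rewrite addrCA; congr (_ + _); rewrite -big_split/=.
by apply: eq_bigr => i _; rewrite mxE mulrDr.
Qed.

Lemma slopeZ (mu a : R) (p : 'rV[R]_n) x : slope mu p (a *: x) = a * slope mu p x.
Proof.
rewrite /slope mxE mulrDr mulrCA; congr (_ + _); rewrite mulr_sumr.
by apply: eq_bigr => i _; rewrite mxE mulrCA.
Qed.

Lemma slope_unit0 (mu : R) (p : 'rV[R]_n) : slope mu p (unit_vec ord0) = mu.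
Proof.
rewrite /slope mxE !eqxx mulr1 big1 ?addr0// => i _.
by rewrite mxE eq_sym/= mulr0.
Qed.

Lemma slope_unitS (mu : R) (p : 'rV[R]_n) (i : 'I_n) :
  slope mu p (unit_vec (lift ord0 i)) = p ord0 i.
Proof.
rewrite /slope mxE/= mulr0 add0r (bigD1 i)//= big1 ?addr0 => [|j ji].
  by rewrite mxE !eqxx mulr1.
rewrite mxE eqxx/= (inj_eq (@lift_inj _ _)).
by rewrite (negbTE ji) mulr0.
Qed.

Lemma slope_line (mu t : R) (p : 'rV[R]_n) i x :
  slope mu p (t *: unit_vec i + x) =
  slope mu p x + t * slope mu p (unit_vec i).
Proof. by rewrite slopeD slopeZ addrC. Qed.

Lemma continuous_coord (i : 'I_n.+1) : continuous (fun x => x ord0 i).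
Proof. exact: coord_continuous. Qed.

Lemma continuous_slope (mu : R) (p : 'rV[R]_n) : continuous (slope mu p).
Proof.
apply: continuous_addf.
  by apply: continuous_mulf; [exact: continuous_cstf | exact: continuous_coord].
apply: continuous_bigsum => i.
by apply: continuous_mulf; [exact: continuous_cstf | exact: continuous_coord].
Qed.

Lemma jet_slope (mu : R) (p : 'rV[R]_n) :
  jet (slope mu p) (fun _ => mu) (fun _ => 0).
Proof.
have P i : (forall x, derivable (slope mu p) x (unit_vec i)) /\
    partial i (slope mu p) = (fun _ => slope mu p (unit_vec i)).
  apply: partial_eq => x; under eq_fun do rewrite slope_line.
  exact: is_derive_affine.
split.
- apply: smoothS; first exact: continuous_slope.
  + by move=> i; exact: (P i).1.
  + by move=> i; rewrite (P i).2; exact: smooth_cst.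
- by rewrite (P ord0).2 slope_unit0.
- apply/funext => x; rewrite /laplacian big1// => i _.
  by rewrite (P i).2 (partial_cst _ i).2.
Qed.

(** The Euclidean square, because the norm of row vectors is the maximum norm,
    which is not smooth. *)
Definition sq_dist y x : R := \sum_i (x ord0 i - y ord0 i) ^+ 2.

Lemma jet_sq_dist y : jet (sq_dist y)
  (fun x => 2 * (x ord0 ord0 - y ord0 ord0)) (fun _ => 2 * n.+1%:R).
Proof.
have coordE (j i : 'I_n.+1) (t : R) x : (t *: unit_vec i + x) ord0 j - y ord0 j =
    (x ord0 j - y ord0 j) + t * (j == i)%:R.
  by rewrite !mxE eqxx/=; ring.
have dcoord (j i : 'I_n.+1) x : is_derive (0 : R) (1 : R)
    (fun t : R => (t *: unit_vec i + x) ord0 j - y ord0 j) (j == i)%:R.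
  by under eq_fun do rewrite coordE; exact: is_derive_affine.
have P i : (forall x, derivable (sq_dist y) x (unit_vec i)) /\
    partial i (sq_dist y) = (fun x => 2 * (x ord0 i - y ord0 i)).
  apply: partial_eq => x.
  have -> : 2 * (x ord0 i - y ord0 i) = \sum_(j < n.+1)
      ((j == i)%:R * (x ord0 j - y ord0 j) + (x ord0 j - y ord0 j) * (j == i)%:R).
    rewrite (bigD1 i)//= eqxx big1 ?addr0 => [|j /negbTE ->].
      by rewrite mul1r mulr1 mulr2n mulrDl mul1r.
    by rewrite mulr0 mul0r addr0.
  apply: is_derive_bigsum => j.
  have := is_derive_mulf (dcoord j i x) (dcoord j i x).
  by rewrite scale0r add0r.
have Q j i : (forall x, derivable (fun x => 2 * (x ord0 j - y ord0 j)) x (unit_vec i)) /\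
    partial i (fun x => 2 * (x ord0 j - y ord0 j)) = (fun _ => 2 * (j == i)%:R).
  by apply: partial_eq => x; apply: is_derive_scalef.
have cc j : continuous (fun x => x ord0 j - y ord0 j).
  by apply: continuous_addf; [exact: continuous_coord | exact: continuous_cstf].
split.
- apply: smoothS.
  + apply: continuous_bigsum => j; under eq_fun do rewrite expr2.
    exact: continuous_mulf.
  + by move=> i; exact: (P i).1.
  + move=> i; rewrite (P i).2; apply: smoothS.
    * by apply: continuous_mulf; [exact: continuous_cstf | exact: cc].
    * by move=> j; exact: (Q i j).1.
    * by move=> j; rewrite (Q i j).2; exact: smooth_cst.
- by rewrite (P ord0).2.
- apply/funext => x; rewrite /laplacian.
  under eq_bigr do rewrite (P _).2 (Q _ _).2 eqxx mulr1.
  by rewrite sumr_const card_ord mulr_natr.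
Qed.

(** The product [exp (- a x_1) cos (b . x' + th)], harmonic when [a] is the
    Euclidean norm of [b]. It is written with [slope] in both factors so that
    all partial derivatives have the same form. *)
Definition wave (a : R) (b : 'rV[R]_n) (th : R) x : R :=
  expR (slope (- a) 0 x) * cos (slope 0 b x + th).

(** Differentiating a cosine shifts its phase by a quarter turn, so that waves
    are closed under partial derivatives up to linear combinations. *)
Lemma partial_wave (a : R) (b : 'rV[R]_n) (th : R) i :
  (forall x, derivable (wave a b th) x (unit_vec i)) /\
  partial i (wave a b th) = (fun x => slope (- a) 0 (unit_vec i) * wave a b th x +
     slope 0 b (unit_vec i) * wave a b (th + pi / 2) x).
Proof.
apply: partial_eq => x.
set A := slope (- a) 0 _; set B := slope 0 b (unit_vec i).
set u := slope (- a) 0 x; set v := slope 0 b x.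
have dA := is_derive_affine u A 0.
have dB := is_derive_affine (v + th) B 0.
have dE := @is_derive1_comp R expR (fun t => u + t * A) 0 _ _ (is_derive_expR _) dA.
have dC := @is_derive1_comp R cos (fun t => (v + th) + t * B) 0 _ _ (is_derive_cos _) dB.
have := is_derive_mulf dE dC.
have <- : (fun t => wave a b th (t *: unit_vec i + x)) =
    (fun t => expR (u + t * A) * cos (v + th + t * B)).
  by apply/funext => t; rewrite /wave !slope_line -/v [v + _ + th]addrAC.
rewrite /= !mul0r !addr0 => H; apply: is_derive_eq H _.
by rewrite /wave -/u -/v addrA cosDpihalf; ring.
Qed.

Lemma continuous_wave (a : R) (b : 'rV[R]_n) (th : R) : continuous (wave a b th).
Proof.
apply: continuous_mulf => x.
  apply: (@continuous_comp _ _ _ (slope (- a) 0) expR).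
    exact: continuous_slope.
  exact: continuous_expR.
apply: (@continuous_comp _ _ _ (fun x => slope 0 b x + th) cos).
  by apply: continuous_addf; [exact: continuous_slope | exact: continuous_cstf].
exact: continuous_cos.
Qed.

Lemma smooth_wave (a : R) (b : 'rV[R]_n) (th : R) : smooth (wave a b th).
Proof.
move=> k; elim: k th => [|k IH] th; split; try exact: continuous_wave; first by [].
move=> i; have [? ->] := partial_wave a b th i; split => //.
by apply: CkD; exact: CkZ.
Qed.

Lemma jet_wave (a : R) (b : 'rV[R]_n) (th : R) : jet (wave a b th)
  (fun x => - a * wave a b th x)
  (fun x => (a ^+ 2 - \sum_i b ord0 i ^+ 2) * wave a b th x).
Proof.
split; first exact: smooth_wave.
  rewrite (partial_wave a b th ord0).2 !slope_unit0.
  by apply/funext => x; rewrite mul0r addr0.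
apply/funext => x; rewrite /laplacian.
have waveP i : partial i (partial i (wave a b th)) x =
   (slope (- a) 0 (unit_vec i) ^+ 2 - slope 0 b (unit_vec i) ^+ 2) * wave a b th x
   + 2 * (slope (- a) 0 (unit_vec i) * slope 0 b (unit_vec i)) *
     wave a b (th + pi / 2) x.
  rewrite (partial_wave a b th i).2.
  have [d1 p1] := partial_wave a b th i.
  have [d2 p2] := partial_wave a b (th + pi / 2) i.
  have [d3 p3] := partialZ (slope (- a) 0 (unit_vec i)) d1.
  have [d4 p4] := partialZ (slope 0 b (unit_vec i)) d2.
  rewrite (partialD d3 d4).2 p3 p4 p1 p2.
  have -> : wave a b (th + pi / 2 + pi / 2) x = - wave a b th x.
    by rewrite /wave !addrA !cosDpihalf sinDpihalf mulrN.
  ring.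
rewrite big_ord_recl waveP !slope_unit0 !expr0n/= subr0 !mulr0 mul0r addr0 sqrrN.
rewrite mulrBl; congr (_ + _); rewrite mulr_suml -sumrN; apply: eq_bigr => i _.
by rewrite waveP !slope_unitS mxE; ring.
Qed.

End halfspace_calculus.

(** * Maxima, contact and minima *)

(** Upper semicontinuity is only assumed along [K], as [v] is semicontinuous on
    the half-space alone; the value [c] excludes the function that is [-oo]
    everywhere. *)
Lemma usc_compact_max (R : realType) (T : topologicalType) (K : set T)
  (g : T -> \bar R) (C c : R) : compact K ->
  (forall x (a : R), K x -> (g x < a%:E)%E ->
     \forall y \near x, K y -> (g y < a%:E)%E) ->
  (forall x, K x -> (g x <= C%:E)%E) ->
  (exists2 x, K x & (c%:E <= g x)%E) ->
  exists2 x, K x & forall y, K y -> (g y <= g x)%E.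
Proof.
move=> /compact_near_coveringP Kcov gusc gC [x0 Kx0 gx0].
pose E : set R := [set r | exists2 x, K x & (r%:E <= g x)%E].
have E0 : E !=set0 by exists c, x0.
have EC : has_ubound E.
  exists C => r [x Kx rx].
  by rewrite -lee_fin; apply: le_trans rx (gC x Kx).
pose S := sup E.
have [[x Kx Sx]|noS] := pselect (exists2 x, K x & (S%:E <= g x)%E).
  exists x => // y Ky; apply: le_trans Sx.
  move: (gC y Ky); case gyE: (g y) => [r| |] //= _; rewrite ?leNye// lee_fin.
  by apply: ub_le_sup => //; exists y => //; rewrite gyE.
have ltS x : K x -> (g x < S%:E)%E.
  by move=> Kx; rewrite ltNge; apply/negP => Sx; apply: noS; exists x.
have : \forall b \near S^'-, K `<=` (fun x => K x -> (g x < b%:E)%E).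
  apply: Kcov => x Kx.
  have [b0 gb0 b0S] : exists2 b0 : R, (g x < b0%:E)%E & b0 < S.
    move: (ltS x Kx); case: (g x) => [r| |]//.
      rewrite lte_fin => rS; exists ((r + S) / 2).
        by rewrite lte_fin; lra.
      lra.
    by move=> _; exists (S - 1); [rewrite ltNyr | lra].
  exists ([set y | K y -> (g y < b0%:E)%E], [set b | b0 < b]) => /=.
    by split; [exact: gusc | exact: nbhs_left_gt].
  by move=> [y b] /= [gy b0b] Ky; apply: lt_trans (gy Ky) _; rewrite lte_fin.
move=> H.
have [b [bS Hb]] : exists b : R, b < S /\ K `<=` (fun x => K x -> (g x < b%:E)%E).
  near (S^'-) => b; exists b; split; near: b => //.
  exact: nbhs_left_lt.
have : sup E <= b.
  apply: ge_sup => // r [x Kx rx]; rewrite -lee_fin; apply: le_trans rx _.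
  by apply: ltW; exact: Hb.
by rewrite leNgt -/S bS.
Unshelve. all: by end_near. Qed.

(** Take the infimum of the parameters [t] for which [w t] lies above [v].
    Just below it some point violates the inequality and, as the family is
    Lipschitz in [t] uniformly in the point, [w t] is within [eta] of [v] there.
    On an unbounded set the gap may fail to be attained, hence the [eta]. *)
Lemma first_contact (R : realType) (X : Type) (H : set X) (v : X -> \bar R)
  (w : R -> X -> R) (L t0 b : R) : 0 < L ->
  (forall t s x, H x -> `|w t x - w s x| <= L * `|t - s|) ->
  (forall x, H x -> (v x <= (w t0 x)%:E)%E) ->
  (forall t, (forall x, H x -> (v x <= (w t x)%:E)%E) -> b <= t) ->
  exists t : R, (forall x, H x -> (v x <= (w t x)%:E)%E) /\
    forall eta : R, 0 < eta -> exists2 x, H x & ((w t x - eta)%:E < v x)%E.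
Proof.
move=> L0 wL vt0 vb.
pose T : set R := [set t | forall x, H x -> (v x <= (w t x)%:E)%E].
have T0 : T !=set0 by exists t0.
have Tb : has_lbound T by exists b.
exists (inf T); split => [x Hx|eta eta0].
  apply/lee_addgt0Pr => e e0.
  have [|t Tt tT] := @inf_adherent R T (e / L) _ (conj T0 Tb).
    by rewrite divr_gt0.
  apply: le_trans (Tt x Hx) _; rewrite -EFinD lee_fin -lerBlDl.
  apply: le_trans (ler_norm _) (le_trans (wL _ _ _ Hx) _).
  rewrite ger0_norm; last by rewrite subr_ge0; exact: ge_inf.
  by rewrite mulrC -ler_pdivlMr// lerBlDl ltW.
have : ~ T (inf T - eta / L).
  move=> /(ge_inf Tb); rewrite leNgt => /negP; apply.
  by rewrite gtrBl divr_gt0.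
move=> /existsNP[x /not_implyP[Hx /negP]]; rewrite -ltNge => vx.
exists x => //; apply: le_lt_trans vx; rewrite lee_fin lerBlDl -lerBlDr.
apply: le_trans (ler_norm _) (le_trans (wL _ _ _ Hx) _).
by rewrite opprB addrC subrK ger0_norm ?divr_ge0 ?(ltW L0) ?(ltW eta0)// mulrC divfK// gt_eqF.
Qed.

Lemma min_second_derivative_ge0 (R : realType) (g g1 : R -> R) (d2 r : R) :
  (forall t, is_derive t (1 : R) g (g1 t)) -> is_derive (0 : R) (1 : R) g1 d2 ->
  0 < r -> (forall t, `|t| < r -> g 0 <= g t) -> 0 <= d2.
Proof.
move=> dg [dg1 d2E] r0 gmin.
have g10 : g1 0 = 0.
  have [_ <-] := dg 0.
  have [] := @derive1_at_min R g (- r) r 0.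
  - by rewrite ge0_cp// ltW.
  - by move=> t _; have [] := dg t.
  - by rewrite in_itv/= oppr_lt0 r0.
  - by move=> t; rewrite in_itv/= => /andP[t1 t2]; apply: gmin; rewrite ltr_norml t1 t2.
  - by [].
rewrite leNgt; apply/negP => d20.
have : \forall h \near 0^', h^-1 *: ((g1 \o shift 0) (h *: 1) - g1 0) < 0.
  have := dg1; rewrite /derivable => /cvgr_lt; apply.
  by move: d20; rewrite -d2E.
move=> /nbhs_ballP[e /= e0 He].
pose t := Num.min e r / 2.
have m0 : 0 < Num.min e r by rewrite lt_min e0 r0.
have t0 : 0 < t by rewrite divr_gt0.
have tm : t < Num.min e r by rewrite /t ltr_pdivrMr// ltr_pMr// ltr1n.
have te : t < e by apply: lt_le_trans tm _; rewrite ge_min lexx.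
have tr : t < r by apply: lt_le_trans tm _; rewrite ge_min lexx orbT.
have [|c] := @MVT R g g1 0 t t0 (fun x _ => dg x).
  by apply: continuous_subspaceT => x; exact: is_derive_continuous (dg x).
rewrite in_itv/= subr0 => /andP[c0 ct] gE.
have : g1 c < 0.
  have := He c; rewrite /= addr0 [c%:A]mulr1 g10 subr0 /ball/= sub0r normrN.
  rewrite ger0_norm ?(ltW c0)// => /(_ (lt_trans ct te)).
  by rewrite gt_eqF// => /(_ isT); rewrite pmulr_rlt0// invr_gt0.
rewrite -(pmulr_llt0 _ t0) -gE subr_lt0 ltNge => /negP; apply.
by apply: gmin; rewrite ger0_norm// ltW.
Qed.

(** * Smooth subcorrectors *)

Section viscosity.
Context {R : realType} {n : nat}.
Implicit Types (x y : 'rV[R]_n.+1) (phi : 'rV[R]_n.+1 -> R).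
Implicit Types (v : 'rV[R]_n.+1 -> \bar R) (f : R -> R) (p : 'rV[R]_n).

Notation H := (@half_space R n).

Lemma usc_half_spaceP v : usc_half_space v <->
  forall x (a : R), H x -> (v x < a%:E)%E ->
    \forall y \near x, H y -> (v y < a%:E)%E.
Proof.
split=> [uv x a Hx va|uv x a].
  have [|V] := uv x (- a); first by rewrite EFinN lteN2.
  move=> nV Va; have {}nV : within H (nbhs x) V.
    by rewrite nbhs_subspace_in.
  apply: (@filterS _ (nbhs x) _ _ _ _ nV) => y VHy /VHy /Va.
  by rewrite EFinN lteN2.
move: x a; suff aux (x : 'rV[R]_n.+1) (a : R) : (a%:E < - v x)%E ->
    exists2 V, nbhs (x : subspace H) V & forall y, V y -> (a%:E < - v y)%E.
  by move=> x a; exact: aux.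
rewrite lteNr -EFinN => va.
have [Hx|nHx] := pselect (H x); last first.
  exists [set x]; last by move=> y ->; rewrite lteNr -EFinN.
  by rewrite /nbhs/= /nbhs_subspace ifF//; apply/negbTE; rewrite notin_setE.
exists [set y | (a%:E < - v y)%E] => //.
have nU := uv x (- a) Hx va.
rewrite /nbhs/= /nbhs_subspace ifT; last by rewrite inE.
apply: (@filterS _ (nbhs x) _ _ _ _ nU) => y Hy /Hy.
by rewrite /= lteNr -EFinN.
Qed.

Lemma near_line x (i : 'I_n.+1) (P : 'rV[R]_n.+1 -> Prop) :
  (\forall y \near x, P y) ->
  exists2 r : R, 0 < r & forall t, `|t| < r -> P (t *: delta_mx ord0 i + x).
Proof.
move=> Px.
have : \forall t \near (0 : R), P (t *: delta_mx ord0 i + x).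
  have c : (fun t : R => t *: (delta_mx ord0 i : 'rV[R]_n.+1) + x) @ (0 : R) -->
      (0 : R) *: (delta_mx ord0 i : 'rV[R]_n.+1) + x.
    by apply: cvgD; [exact: scalel_continuous | exact: cvg_cst].
  by apply: c; rewrite scale0r add0r.
move=> /nbhs_ballP[r /= r0 Hr]; exists r => // t tr; apply: Hr.
by rewrite /ball/= sub0r normrN.
Qed.

(** If a test function touches from above, the difference has a local minimum:
    at interior points its pure second derivatives are nonnegative, and at
    boundary points its inward derivative is. *)
Lemma smooth_subcorrector f (u dn lap : 'rV[R]_n.+1 -> R) (mu C : R) p :
  jet u dn lap -> (forall x, H x -> 0 <= lap x) ->
  (forall x, half_space_boundary x -> f (u x) <= dn x) -> 0 < C ->
  (forall x, H x -> u x <= slope mu p x + C) ->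
  subcorrector f (fun x => (u x)%:E) mu p.
Proof.
move=> [su dnE lapE] lap0 bd C0 uC; split => //; last first.
  by exists C => // x Hx; rewrite lee_fin uC.
split => //.
  apply/usc_half_spaceP => x a Hx; rewrite lte_fin => ua.
  have := (smooth_continuous su) x; move=> /cvgr_lt /(_ _ ua).
  by apply: filterS => y uy _; rewrite lte_fin.
move=> phi x0 sphi [Hx0 /= [ux0] touch].
pose h x := phi x + (-1) * u x.
have hu : smooth h by move=> k; apply: CkD => //; exact: CkZ.
have hx0 : h x0 = 0 by rewrite /h ux0 mulN1r subrr.
have hP : \forall x \near x0, H x -> h x0 <= h x.
  apply: (@filterS _ (nbhs x0) _ _ _ _ touch) => y uy Hy; rewrite hx0 /h mulN1r subr_ge0.
  by rewrite -lee_fin; exact: uy.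
have du i x : derivable u x (delta_mx ord0 i) by exact: smooth_derivable.
have dphi i x : derivable phi x (delta_mx ord0 i) by exact: smooth_derivable.
have ph i : partial i h = fun x => partial i phi x + (-1) * partial i u x.
  have [dz pz] := partialZ (-1) (du i).
  by rewrite /h (partialD (dphi i) dz).2 pz.
have dh i x : derivable h x (delta_mx ord0 i) by exact: smooth_derivable.
have lineh i := fun t => is_derive_line (dh i (t *: delta_mx ord0 i + x0)).
have [x00|x0n0] := eqVneq (x0 ord0 ord0) 0.
  right; split => //; rewrite ux0 in bd *; rewrite /= -ux0.
  apply: le_trans (bd _ x00) _; rewrite -dnE -subr_ge0.
  have -> : partial ord0 phi x0 - partial ord0 u x0 = partial ord0 h x0.
    by rewrite ph mulN1r.
  have [r r0 hr] := near_line ord0 hP.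
  have := lineh ord0 0; rewrite scale0r add0r.
  move=> /is_derive_min_right_ge0 /(_ r0); apply => t /andP[t0 tr].
  rewrite scale0r add0r; apply: hr; first by rewrite ger0_norm// ltW.
  by rewrite /half_space/= !mxE !eqxx/= mulr1 x00 addr0 ltW.
left.
have x0pos : 0 < x0 ord0 ord0 by rewrite lt_neqAle eq_sym x0n0; exact: Hx0.
have inH : \forall x \near x0, H x.
  have := @continuous_coord R n ord0 x0; move=> /cvgr_gt /(_ _ x0pos).
  by apply: filterS => y y0; rewrite /half_space/= ltW.
have hP2 : \forall x \near x0, h x0 <= h x.
  by apply: filterS2 hP inH => y; apply.
have lapu : 0 <= laplacian u x0 by rewrite lapE; exact: lap0.
apply: (le_trans lapu); rewrite -subr_ge0 /laplacian -sumrB.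
apply: sumr_ge0 => i _.
have -> : partial i (partial i phi) x0 - partial i (partial i u) x0 =
    partial i (partial i h) x0.
  rewrite ph.
  have d1 x : derivable (partial i u) x (delta_mx ord0 i).
    by apply: smooth_derivable; exact: smooth_partial.
  have d2 x : derivable (partial i phi) x (delta_mx ord0 i).
    by apply: smooth_derivable; exact: smooth_partial.
  have [dz pz] := partialZ (-1) d1.
  by rewrite (partialD d2 dz).2 pz mulN1r.
have [r r0 hr] := near_line i hP2.
have d2h : derivable (partial i h) (0 *: delta_mx ord0 i + x0) (delta_mx ord0 i).
  by apply: smooth_derivable; exact: smooth_partial.
have := is_derive_line d2h; rewrite scale0r add0r => d2h'.
apply: (@min_second_derivative_ge0 R (fun t => h (t *: delta_mx ord0 i + x0))
  (fun t => partial i h (t *: delta_mx ord0 i + x0)) _ r) => //.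
by move=> t /hr; rewrite scale0r add0r.
Qed.

End viscosity.

(** * Comparison with smooth supersolutions *)

Section comparison.
Context {R : realType} {n : nat}.
Implicit Types (x y : 'rV[R]_n.+1) (phi : 'rV[R]_n.+1 -> R).
Implicit Types (v : 'rV[R]_n.+1 -> \bar R) (f : R -> R) (p : 'rV[R]_n).

Notation H := (@half_space R n).

Definition euclid p : R := Num.sqrt (\sum_i p ord0 i ^+ 2).

Lemma cos_lipschitz (a b : R) : `|cos a - cos b| <= `|a - b|.
Proof.
rewrite -ler_sqr ?nnegrE// [leLHS]real_normK ?num_real//.
apply: le_trans (sqr_cosB_le a b) _.
rewrite (_ : `|a - b| ^+ 2 = 4 * (`|a - b| / 2) ^+ 2); last by field.
rewrite ler_pM2l// ler_pXn2r// ?nnegrE ?divr_ge0//.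
by rewrite ge_min lexx orbT.
Qed.

Section trig_wave.
Variables (m : nat) (c ph : 'I_m -> R) (k : 'I_m -> nat) (p : 'rV[R]_n).

Definition trig (s : R) : R :=
  \sum_i c i * cos ((k i)%:R * (2 * pi * s) + ph i).

(** The normal derivative on the boundary of the bounded harmonic extension of
    [s |-> trig s] composed with [s = p . x']. *)
Definition trig_dn (s : R) : R :=
  \sum_i - (2 * pi * euclid p * (k i)%:R) *
    (c i * cos ((k i)%:R * (2 * pi * s) + ph i)).

(** The bounded harmonic extension to the half-space of
    [x' |-> trig (p . x' + t)]. *)
Definition trig_wave (t : R) x : R :=
  \sum_i c i * wave (2 * pi * euclid p * (k i)%:R)
     ((2 * pi * (k i)%:R) *: p) ((k i)%:R * (2 * pi * t) + ph i) x.

Definition trig_wave_dn (t : R) x : R :=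
  \sum_i c i * (- (2 * pi * euclid p * (k i)%:R) *
    wave (2 * pi * euclid p * (k i)%:R)
     ((2 * pi * (k i)%:R) *: p) ((k i)%:R * (2 * pi * t) + ph i) x).

Lemma jet_trig_wave t : jet (trig_wave t) (trig_wave_dn t) (fun _ => 0).
Proof.
have -> : (fun _ : 'rV[R]_n.+1 => 0 : R) = (fun x => \sum_(i < m) c i *
  (((2 * pi * euclid p * (k i)%:R) ^+ 2 -
     \sum_j ((2 * pi * (k i)%:R) *: p) ord0 j ^+ 2) *
    wave (2 * pi * euclid p * (k i)%:R)
     ((2 * pi * (k i)%:R) *: p) ((k i)%:R * (2 * pi * t) + ph i) x)).
  apply/funext => x; rewrite big1// => i _.
  under eq_bigr do rewrite mxE exprMn.
  rewrite -mulr_sumr.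
  have -> : \sum_j p ord0 j ^+ 2 = euclid p ^+ 2.
    by rewrite /euclid sqr_sqrtr// sumr_ge0// => j _; exact: sqr_ge0.
  by rewrite -exprMn mulrAC subrr mul0r mulr0.
by apply: jet_sum => i; apply: jetZ; exact: jet_wave.
Qed.

Lemma slope0_Z (b : R) x : slope 0 (b *: p) x = b * slope 0 p x.
Proof.
rewrite /slope !mul0r !add0r mulr_sumr.
by apply: eq_bigr => i _; rewrite mxE mulrA.
Qed.

Lemma wave_boundary (a b t h : R) x : half_space_boundary x ->
  wave a (b *: p) h x = cos (b * slope 0 p x + h).
Proof.
move=> x0; rewrite /wave slope0_Z; have -> : slope (- a) 0 x = 0.
  rewrite /slope x0 mulr0 add0r big1// => i _.
  by rewrite mxE mul0r.
by rewrite expR0 mul1r.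
Qed.

Lemma trig_wave_boundary t x : half_space_boundary x ->
  trig_wave t x = trig (slope 0 p x + t).
Proof.
move=> x0; apply: eq_bigr => i _; rewrite wave_boundary//.
by congr (_ * cos _); ring.
Qed.

Lemma trig_wave_dn_boundary t x : half_space_boundary x ->
  trig_wave_dn t x = trig_dn (slope 0 p x + t).
Proof.
move=> x0; apply: eq_bigr => i _; rewrite wave_boundary// mulrCA.
by congr (_ * (_ * cos _)); ring.
Qed.

Lemma slope_normal (a : R) x : slope a 0 x = a * x ord0 ord0.
Proof. by rewrite /slope big1 ?addr0// => i _; rewrite mxE mul0r. Qed.

Lemma expR_decay (a : R) x : 0 <= a -> H x -> 0 <= expR (slope (- a) 0 x) <= 1.
Proof.
move=> a0 Hx; rewrite expR_ge0/= -expR0 ler_expR slope_normal mulNr oppr_le0.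
exact: mulr_ge0.
Qed.

Lemma euclid_freq_ge0 i : 0 <= 2 * pi * euclid p * (k i)%:R.
Proof. by rewrite !mulr_ge0 ?pi_ge0 ?sqrtr_ge0. Qed.

Lemma trig_wave_bound t x : H x -> `|trig_wave t x| <= \sum_i `|c i|.
Proof.
move=> Hx; apply: le_trans (ler_norm_sum _ _ _) _; apply: ler_sum => i _.
rewrite normrM ler_piMr// normrM.
have /andP[e0 e1] := expR_decay (euclid_freq_ge0 i) Hx.
by rewrite ger0_norm// mulr_ile1// cos_max.
Qed.

Lemma trig_wave_lipschitz t s x : H x -> `|trig_wave t x - trig_wave s x| <=
  (\sum_i `|c i| * ((k i)%:R * (2 * pi))) * `|t - s|.
Proof.
move=> Hx; rewrite /trig_wave -sumrB mulr_suml.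
apply: le_trans (ler_norm_sum _ _ _) _; apply: ler_sum => i _.
rewrite -mulrBr normrM -[leRHS]mulrA ler_wpM2l// /wave -mulrBr normrM.
have /andP[e0 e1] := expR_decay (euclid_freq_ge0 i) Hx.
rewrite ger0_norm//; apply: le_trans (ler_wpM2r _ e1) _ => //.
rewrite mul1r; apply: le_trans (cos_lipschitz _ _) _.
set A := slope 0 _ x; set K := (k i)%:R.
have -> : A + (K * (2 * pi * t) + ph i) - (A + (K * (2 * pi * s) + ph i)) =
  K * (2 * pi) * (t - s) by ring.
by rewrite normrM [X in X * _]ger0_norm// !mulr_ge0 ?pi_ge0.
Qed.

End trig_wave.
Lemma slope_split (a : R) p x : slope a p x = a * x ord0 ord0 + slope 0 p x.
Proof. by rewrite /slope mul0r add0r. Qed.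

Lemma wave_normal x : wave 1 0 0 x = expR (- x ord0 ord0).
Proof. by rewrite /wave !slope_normal mulN1r mul0r add0r cos0 mulr1. Qed.

Lemma sq_dist_ge0 y x : 0 <= sq_dist y x.
Proof. by apply: sumr_ge0 => i _; exact: sqr_ge0. Qed.

Lemma coord_le_sq_dist y x i : sq_dist y x <= 1 -> `|x ord0 i - y ord0 i| <= 1.
Proof.
move=> d1; rewrite -ler_sqr ?nnegrE// real_normK ?num_real// expr1n.
apply: le_trans d1; rewrite /sq_dist (bigD1 i)//= lerDl.
by apply: sumr_ge0 => j _; exact: sqr_ge0.
Qed.

Lemma half_space_box_compact y :
  compact [set x | H x /\ forall i, `|x ord0 i - y ord0 i| <= 1].
Proof.
pose A (i : 'I_n.+1) : R :=
  if i == ord0 then Num.max 0 (y ord0 i - 1) else y ord0 i - 1.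
rewrite (_ : [set _ | _] =
    [set x : 'rV[R]_n.+1 | forall i, `[A i, y ord0 i + 1]%classic (x ord0 i)]).
  apply: (@rV_compact _ _ (fun i => `[A i, y ord0 i + 1]%classic)) => i.
  exact: segment_compact.
apply/seteqP; split=> [x /= [Hx xy] i|x /= xA].
  have := xy i; rewrite ler_norml in_itv/= /A => /andP[h1 h2].
  apply/andP; split; last by lra.
  case: eqP => [i0|_]; last by lra.
  rewrite i0 in h1 *; rewrite ge_max; apply/andP; split; last by lra.
  exact: Hx.
split=> [|i].
  have := xA ord0; rewrite in_itv/= /A eqxx ge_max => /andP[/andP[h _] _].
  exact: h.
have := xA i; rewrite in_itv/= /A ler_norml => /andP[h1 h2].
apply/andP; split; last by lra.
by move: h1; case: eqP => [_|_]; rewrite ?ge_max; [move=> /andP[_]|]; lra.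
Qed.

(** A smooth planar supersolution with slope [a] bounds from below the slope of
    every subcorrector. If [mu < a], tilt the supersolution by a term that makes
    it strict and still steeper than [mu], and shift its variable
    [s = p . x' + t] by decreasing [t] until first contact with [v]; every member
    of the family is a strict supersolution, as the hypothesis holds for all
    [s]. The touching may happen only at
    infinity, so a near-contact point [xb] is used, together with a quadratic
    penalisation around it. Since the supersolution is steeper than [v], near
    contact happens at bounded height, where strictness is uniform. *)
Theorem subcorrector_slope_ge (m : nat) (c ph : 'I_m -> R) (k : 'I_m -> nat)
    p f v (a mu : R) :
  (forall e : R, 0 < e -> exists2 d : R, 0 < d &
     forall s t : R, `|s - t| < d -> `|f s - f t| <= e) ->
  (forall s, a + trig_dn c ph k p s <= f (s + trig c ph k s)) ->
  subcorrector f v mu p -> a <= mu.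
Proof.
move=> fuc super [[vNy /usc_half_spaceP vusc visc] [C C0 vC] v0].
rewrite leNgt; apply/negP => mua.
pose dl : R := (a - mu) / 4; pose al : R := a - 3 * dl.
have dl0 : 0 < dl by rewrite divr_gt0// subr_gt0.
have almu : al - mu = dl by rewrite /al /dl; field.
(* The term dl (1 - exp (- x_1)) is strictly superharmonic and vanishes on the
   boundary, where it adds dl to the normal derivative; a - al = 3 dl pays for
   it and leaves a margin of 2 dl. *)
pose w (t : R) x : R := slope al p x + (t + dl) + (- dl) * wave 1 0 0 x +
  trig_wave c ph k p t x.
pose Bc : R := \sum_i `|c i|.
have Bc0 : 0 <= Bc by apply: sumr_ge0.
have wave_le x : H x -> 0 <= wave 1 0 0 x <= 1.
  move=> Hx; rewrite wave_normal expR_ge0/= -expR0 ler_expR oppr_le0.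
  exact: Hx.
have w_ge t x : H x -> slope al p x + t - Bc <= w t x.
  move=> Hx; have /andP[e0 e1] := wave_le _ Hx.
  have := trig_wave_bound c ph k p t Hx; rewrite ler_norml => /andP[b1 _].
  have := ler_wpM2l (ltW dl0) e1; rewrite /w -/Bc in b1 *; lra.
have H0 : H 0 by rewrite /half_space/= mxE.
have w_le t : w t 0 <= t + dl + Bc.
  have /andP[e0 e1] := wave_le _ H0.
  have := trig_wave_bound c ph k p t H0; rewrite ler_norml => /andP[_ b2].
  have s0 : slope al p 0 = 0.
    have := slopeZ al 0 p (0 : 'rV[R]_n.+1); rewrite scale0r => ->.
    by rewrite mul0r.
  have := mulr_ge0 (ltW dl0) e0; rewrite /w s0 -/Bc in b2 *; lra.
pose L : R := 1 + \sum_i `|c i| * ((k i)%:R * (2 * pi)).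
have L0 : 0 < L.
  by rewrite ltr_pwDl// sumr_ge0// => i _; rewrite !mulr_ge0 ?pi_ge0.
have wL t s x : H x -> `|w t x - w s x| <= L * `|t - s|.
  move=> Hx; rewrite /L mulrDl mul1r.
  have -> : w t x - w s x = (t - s) + (trig_wave c ph k p t x - trig_wave c ph k p s x).
    by rewrite /w; ring.
  apply: le_trans (ler_normD _ _) _; rewrite lerD2l.
  exact: trig_wave_lipschitz.
have [t [vw contact]] : exists t : R, (forall x, H x -> (v x <= (w t x)%:E)%E) /\
    forall eta : R, 0 < eta -> exists2 x, H x & ((w t x - eta)%:E < v x)%E.
  apply: (@first_contact R _ H v w L (C + Bc) (fine (v 0) - dl - Bc)) => //.
    move=> x Hx; apply: le_trans (vC x Hx) _; rewrite lee_fin.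
    apply: le_trans (w_ge _ _ Hx); rewrite (slope_split al) (slope_split mu).
    have : mu * x ord0 ord0 <= al * x ord0 ord0.
      by apply: ler_wpM2r => //; lra.
    lra.
  move=> t /(_ 0 H0).
  have : v 0 \is a fin_num by rewrite fin_numE v0 vNy.
  move=> /fineK <-; rewrite lee_fin/= => h.
  by have := w_le t; lra.
(* Y bounds the height of the contact point, and dl * rho is the resulting
   lower bound on the superharmonicity of w t there. *)
pose Y : R := (C - t + Bc + 1) / dl + 1.
pose rho : R := expR (- Y).
have rho0 : 0 < rho by exact: expR_gt0.
have [d d0 fd] := fuc dl dl0.
have n0 : 0 < n.+1%:R :> R by rewrite ltr0n.
pose eta : R := Num.min (Num.min 1 (d / 2)) (Num.min (dl / 8) (dl * rho / (8 * n.+1%:R))).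
have eta0 : 0 < eta.
  have d8 : 0 < dl * rho / (8 * n.+1%:R).
    by apply: divr_gt0; [exact: mulr_gt0 | rewrite mulr_gt0].
  by rewrite !lt_min d8 ltr01 (divr_gt0 d0)// (divr_gt0 dl0).
have eta1 : eta <= 1 by rewrite /eta !ge_min lexx.
have etad : eta < d.
  apply: (@le_lt_trans _ _ (d / 2)); first by rewrite /eta !ge_min lexx orbT.
  lra.
have etadl : 4 * eta < dl.
  have : eta <= dl / 8 by rewrite /eta !ge_min lexx !orbT.
  lra.
have etarho : 4 * eta * n.+1%:R < dl * rho.
  have : eta <= dl * rho / (8 * n.+1%:R) by rewrite /eta !ge_min lexx !orbT.
  rewrite ler_pdivlMr ?mulr_gt0// => h.
  have := mulr_gt0 dl0 rho0; lra.
have [xb Hxb vxb] := contact eta eta0.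
have xbY : xb ord0 ord0 <= Y - 1.
  have := lt_le_trans vxb (vC xb Hxb); rewrite lte_fin.
  have := w_ge t xb Hxb; rewrite (slope_split al) (slope_split mu) => h1 h2.
  rewrite /Y addrK ler_pdivlMr// -almu mulrBr; lra.
(* At distance 1 from xb the penalty 2 eta exceeds the gap eta at xb, so the
   maximum of v - phi0 is attained inside. *)
pose phi0 x := w t x + 2 * eta * sq_dist xb x.
have jw : jet (w t) (fun x => al + 0 + (- dl) * (- 1 * wave 1 0 0 x) +
     trig_wave_dn c ph k p t x)
   (fun x => 0 + 0 + (- dl) * ((1 ^+ 2 - \sum_(i < n) (0 : 'rV[R]_n) ord0 i ^+ 2) *
      wave 1 0 0 x) + 0).
  apply: jetD; last exact: jet_trig_wave.
  apply: jetD; last by apply: jetZ; exact: jet_wave.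
  by apply: jetD; [exact: jet_slope | exact: jet_cst].
have jphi0 := jetD jw (jetZ (2 * eta) (jet_sq_dist xb)).
have cphi0 : continuous phi0 by have [/smooth_continuous] := jphi0.
pose K := [set x | H x /\ forall i, `|x ord0 i - xb ord0 i| <= 1].
have Kxb : K xb by split => // i; rewrite subrr normr0.
pose g x := (v x - (phi0 x)%:E)%E.
have phi0xb : phi0 xb = w t xb.
  by rewrite /phi0 /sq_dist big1 ?mulr0 ?addr0// => i _; rewrite subrr expr0n.
have [x0 [Hx0 Kx0] gmax] : exists2 x, K x & forall y, K y -> (g y <= g x)%E.
  apply: (@usc_compact_max R _ K g 0 (- eta)).
  - exact: half_space_box_compact.
  - move=> x b [Hx _]; rewrite /g lteBlDr// -EFinD => vb.
    have [b1 vb1 b1b] : exists2 b1 : R, (v x < b1%:E)%E & b1 < b + phi0 x.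
      move: (vNy x Hx) vb; case: (v x) => [r| |]//= _.
        by rewrite lte_fin => rb; exists ((r + (b + phi0 x)) / 2);
          rewrite ?lte_fin; lra.
      by move=> _; exists (b + phi0 x - 1); [rewrite ltNyr | lra].
    have := vusc x b1 Hx vb1.
    have : \forall y \near x, b1 - b < phi0 y.
      by have := cphi0 x; move=> /cvgr_gt; apply; lra.
    apply: filterS2 => y yb vy [Hy _].
    rewrite lteBlDr// -EFinD; apply: lt_trans (vy Hy) _; rewrite lte_fin; lra.
  - move=> x [Hx _]; rewrite /g leeBlDr// add0e; apply: le_trans (vw x Hx) _.
    by rewrite lee_fin /phi0 lerDl !mulr_ge0 ?sq_dist_ge0// ltW.
  - exists xb => //; rewrite /g leeBrDr// -EFinD phi0xb addrC.
    exact: ltW.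
have gx0 : ((phi0 x0 - eta)%:E < v x0)%E.
  have := gmax xb Kxb; rewrite /g phi0xb leeBlDr// => h.
  have := lt_le_trans vxb h.
  case: (v x0) (vNy x0 Hx0) => [r| |]//= _.
  by rewrite -EFinB -EFinD !lte_fin; lra.
have vx0fin : v x0 \is a fin_num.
  rewrite fin_numE vNy// andbT; apply/eqP => vE.
  by move: gx0; rewrite vE ltNge leNye.
pose r := fine (v x0).
have vr : v x0 = r%:E by rewrite fineK.
move: gx0; rewrite vr lte_fin => rlow.
have rup : r <= w t x0 by rewrite -lee_fin -vr; exact: vw.
have sq_small : sq_dist xb x0 < 1.
  rewrite -(ltr_pM2l eta0) mulr1.
  have := sq_dist_ge0 xb x0; move: rlow; rewrite /phi0; lra.
have x0Y : x0 ord0 ord0 <= Y.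
  have := Kx0 ord0; rewrite ler_norml => /andP[_]; lra.
pose phi x := phi0 x + (r - phi0 x0).
have jphi := jetD jphi0 (jet_cst (r - phi0 x0)).
have [sphi dnphi lapphi] := jphi.
have touch : touches_above phi v x0.
  split => //; first by rewrite vr /phi addrC subrK.
  have nK : \forall y \near x0, sq_dist xb y < 1.
    have [/smooth_continuous sc _ _] := jet_sq_dist xb.
    by have := sc x0; move=> /cvgr_lt; apply.
  apply: (@filterS _ (nbhs x0) _ _ _ _ nK) => y ylt Hy.
  have Ky : K y by split => // i; apply: coord_le_sq_dist; exact: ltW.
  have := gmax y Ky; rewrite /g vr leeBlDr// -EFinB -EFinD.
  by rewrite /phi addrC.
have phiE : phi = (fun x => w t x + 2 * eta * sq_dist xb x + (r - phi0 x0)) by [].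
case: (visc phi x0 sphi touch) => [|[x00]].
  rewrite phiE lapphi expr1n big1 => [|i _]; last by rewrite mxE expr0n.
  rewrite wave_normal.
  have : rho <= expR (- x0 ord0 ord0) by rewrite ler_expR lerN2.
  move=> /(ler_wpM2l (ltW dl0)); lra.
have w1 : wave 1 0 0 x0 = 1 by rewrite wave_normal x00 oppr0 expR0.
rewrite phiE dnphi trig_wave_dn_boundary// w1 => Hbd.
have := super (slope 0 p x0 + t).
have wE : slope 0 p x0 + t + trig c ph k (slope 0 p x0 + t) = w t x0.
  by rewrite /w trig_wave_boundary// w1 (slope_split al) x00; ring.
rewrite wE => Hsup.
have fr : `|f (w t x0) - f r| <= dl.
  apply: fd; rewrite ger0_norm ?subr_ge0//.
  move: rlow; rewrite /phi0; have := mulr_ge0 (ltW eta0) (sq_dist_ge0 xb x0); lra.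
have fr' := le_trans (ler_norm _) fr.
have x0xb : x0 ord0 ord0 - xb ord0 ord0 <= 0.
  rewrite x00 sub0r oppr_le0; exact: Hxb.
move: Hbd; rewrite -/r; have := ler_wpM2l (ltW eta0) x0xb.
rewrite /al; lra.
Qed.

End comparison.

(** * The homogenized coefficients *)

Section effective_slopes.
Context {R : realType} {n : nat}.
Implicit Types (x : 'rV[R]_n.+1) (phi : 'rV[R]_n.+1 -> R).
Implicit Types (v : 'rV[R]_n.+1 -> \bar R) (f : R -> R) (p : 'rV[R]_n).

(** The hypothesis only concerns the values taken by [p . x' + t]: for [p = 0]
    this is the single number [t]. *)
Lemma planar_subcorrector (m : nat) (c ph : 'I_m -> R) (k : 'I_m -> nat)
    p f (a t : R) :
  (forall x, f (slope 0 p x + t + trig c ph k (slope 0 p x + t)) <=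
     a + trig_dn c ph k p (slope 0 p x + t)) ->
  exists v, subcorrector f v a p.
Proof.
move=> sub.
exists (fun x => (slope a p x + t + trig_wave c ph k p t x)%:E).
apply: (smooth_subcorrector (C := `|t| + \sum_i `|c i| + 1)
  (jetD (jetD (jet_slope a p) (jet_cst t)) (jet_trig_wave c ph k p t))).
- by move=> x _; rewrite !addr0.
- move=> x x0; rewrite trig_wave_boundary// trig_wave_dn_boundary// addr0.
  by rewrite (slope_split a) x0 mulr0 add0r; exact: sub.
- by rewrite ltr_pwDr// addr_ge0// sumr_ge0.
- move=> x Hx; have := trig_wave_bound c ph k p t Hx.
  rewrite ler_norml => /andP[_ h]; have := ler_norm t; lra.
Qed.

Lemma ereal_inf_EFin_eq (S : set R) (q : R) : (forall r, S r -> q <= r) ->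
  (forall e, 0 < e -> exists2 r, S r & r <= q + e) ->
  ereal_inf [set r%:E | r in S] = q%:E.
Proof.
move=> lb adh; apply/eqP; rewrite eq_le; apply/andP; split.
  apply/lee_addgt0Pr => e /adh[r Sr rq]; apply: ge_ereal_inf.
  by exists r%:E; [exists r | rewrite -EFinD lee_fin].
by apply: le_ereal_inf_tmp => _ [r Sr <-]; rewrite lee_fin; exact: lb.
Qed.

Lemma euclid_gt0 p : p != 0 -> 0 < euclid p.
Proof.
move=> pn0; rewrite /euclid sqrtr_gt0 lt_neqAle sumr_ge0 ?andbT; last first.
  by move=> i _; exact: sqr_ge0.
apply/negP => /eqP/esym/psumr_eq0P p0; move/negP: pn0; apply; apply/eqP/rowP => i.
rewrite mxE; apply/eqP; rewrite -sqrf_eq0; apply/eqP; apply: p0 => // j _.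
exact: sqr_ge0.
Qed.

(** For [p = 0] the affine functions [m x_1 + const] are the extremal
    barriers, on both sides. For [p != 0] an approximate corrector of slope 0
    with error [e] is, after tilting by [e x_1] or [- e x_1], a subcorrector of
    slope [e] and a supersolution of slope [- e]. *)
Theorem Q_low_value f F p (m : R) : continuous f -> periodic f 1 ->
  periodic F 1 -> (forall s : R, is_derive s (1 : R) F (f s)) -> is_min f m ->
  Q_low f p = (if p == 0 then m else 0)%:E.
Proof.
move=> cf fper Fper dF [[t0 ft0] fmin].
have fuc := periodic_unif_continuous cf fper.
have [->|pn0] := eqVneq p 0.
  pose c (i : 'I_0) : R := 0; pose k (i : 'I_0) := 0%N.
  apply: ereal_inf_EFin_eq => [r [v sub]|e e0].
    apply: (@subcorrector_slope_ge R n 0 c c k 0 f v m r fuc _ sub) => s.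
    by rewrite /trig_dn /trig !big_ord0 !addr0.
  exists m; last by rewrite lerDl ltW.
  apply: (@planar_subcorrector 0 c c k 0 f m t0) => x.
  by rewrite /trig_dn /trig !big_ord0 !addr0 slope_normal mul0r add0r ft0.
have app e (e0 : 0 < e) := approximate_corrector cf fper Fper dF (euclid_gt0 pn0) e0.
apply: ereal_inf_EFin_eq => [r [v sub]|e e0].
  rewrite leNgt; apply/negP => r0.
  have [|m' [c [ph [k Happ]]]] := app (- r / 2); first by lra.
  suff : r / 2 <= r by lra.
  apply: (subcorrector_slope_ge (c := c) (ph := ph) (k := k) fuc _ sub) => s.
  by have := Happ s; rewrite -/(trig_dn c ph k p s) -/(trig c ph k s) ler_norml; lra.
have [m' [c [ph [k Happ]]]] := app e e0.
exists e; last by rewrite add0r.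
apply: (@planar_subcorrector m' c ph k p f e 0) => x.
have := Happ (slope 0 p x + 0).
by rewrite -/(trig_dn c ph k p _) -/(trig c ph k _) ler_norml; lra.
Qed.

Lemma jetN phi : smooth phi -> smooth (fun x => - phi x) /\
  (forall x, partial ord0 (fun x => - phi x) x = - partial ord0 phi x /\
    laplacian (fun x => - phi x) x = - laplacian phi x).
Proof.
move=> sphi; have := @jetZ R n (-1) phi _ _ (And3 sphi erefl erefl).
under eq_fun do rewrite mulN1r.
by move=> [? -> ->]; split => // x; rewrite !mulN1r.
Qed.

Lemma slopeN (mu : R) p x : slope (- mu) (- p) x = - slope mu p x.
Proof.
rewrite /slope mulNr opprD -sumrN; congr (_ + _).
by apply: eq_bigr => i _; rewrite mxE mulNr.
Qed.

Definition reflected f (s : R) : R := - f (- s).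

Lemma supercorrector_reflect f v (mu : R) p : supercorrector f v mu p ->
  subcorrector (reflected f) (fun x => (- v x)%E) (- mu) (- p).
Proof.
move=> [[vN vlsc visc] [C C0 vC] v0]; split.
- split.
  + by move=> x /vN; rewrite eqe_oppLR.
  + by rewrite /usc_half_space; under eq_fun do rewrite oppeK.
  + move=> phi x0 sphi [Hx0 vx0 touch].
    have [sN /(_ x0) [dN lN]] := jetN sphi.
    have vx0' : v x0 = (- phi x0)%:E by rewrite EFinN -vx0 oppeK.
    case: (visc (fun x => - phi x) x0 sN).
    * split => //; apply: (@filterS _ (nbhs x0) _ _ _ _ touch) => y vy /vy.
      by rewrite EFinN leeNl.
    * by rewrite lN oppr_le0; left.
    * rewrite dN vx0' /= => -[x00 H]; right; split => //.
      by rewrite /reflected opprK lerNl.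
- exists C => // x Hx; rewrite slopeN leeNl -EFinN opprD opprK; exact: vC.
- by rewrite eqe_oppLR.
Qed.

Lemma subcorrector_reflect f v (mu : R) p : subcorrector f v mu p ->
  supercorrector (reflected f) (fun x => (- v x)%E) (- mu) (- p).
Proof.
move=> [[vN vusc visc] [C C0 vC] v0]; split.
- split.
  + by move=> x /vN; rewrite eqe_oppLR.
  + exact: vusc.
  + move=> phi x0 sphi [Hx0 vx0 touch].
    have [sN /(_ x0) [dN lN]] := jetN sphi.
    have vx0' : v x0 = (- phi x0)%:E by rewrite EFinN -vx0 oppeK.
    case: (visc (fun x => - phi x) x0 sN).
    * split => //; apply: (@filterS _ (nbhs x0) _ _ _ _ touch) => y vy /vy.
      by rewrite EFinN leeNr.
    * by rewrite lN oppr_ge0; left.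
    * rewrite dN vx0' /= => -[x00 H]; right; split => //.
      by rewrite /reflected opprK lerNr.
- exists C => // x Hx; rewrite slopeN leeNr -EFinN opprD !opprK; exact: vC.
- by rewrite eqe_oppLR.
Qed.

(** The change of unknown [v |-> - v] exchanges subcorrectors for [f] with
    supercorrectors for [s |-> - f (- s)], and reverses the slopes. *)
Lemma Q_up_reflect f p : Q_up f p = (- Q_low (reflected f) (- p))%E.
Proof.
have ffE : reflected (reflected f) = f.
  by apply/funext => s; rewrite /reflected !opprK.
rewrite /Q_up ereal_supEN; congr (- ereal_inf _)%E; apply/seteqP; split => z /=.
  move=> [_ [mu [v sv] <-] <-]; exists (- mu) => //.
  by exists (fun x => (- v x)%E); exact: supercorrector_reflect.
move=> [mu [v sv] <-]; exists (- mu)%:E; last by rewrite EFinN oppeK.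
exists (- mu) => //; exists (fun x => (- v x)%E).
by have := subcorrector_reflect sv; rewrite ffE opprK.
Qed.

End effective_slopes.

(** For exponents above 1 the function is differentiable; for the others the
    Hoelder bound itself gives continuity. *)
Lemma holder_class_continuous (R : realType) (alpha : R) (f : R -> R) :
  holder_class alpha f -> continuous f.
Proof.
move=> [[|k] [b [/andP[b0 _] _ dk [K HK]]]] x.
  have {}HK u w : `|f u - f w| <= K * `|u - w| `^ b by exact: HK.
  pose K1 := `|K| + 1.
  have K10 : 0 < K1 by rewrite ltr_wpDl.
  apply/cvgrPdist_lt => e e0.
  pose d := (e / K1) `^ b^-1.
  have eK : 0 < e / K1 by rewrite divr_gt0.
  have d0 : 0 < d by rewrite powR_gt0.
  near=> y.
  have xy : `|x - y| < d.
    by near: y; apply/nbhs_ballP; exists d.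
  apply: le_lt_trans (HK x y) _.
  apply: (@le_lt_trans _ _ (K1 * `|x - y| `^ b)).
    apply: ler_wpM2r; first exact: powR_ge0.
    by apply: le_trans (ler_norm _) _; rewrite lerDl.
  rewrite mulrC -ltr_pdivlMr//.
  have -> : e / K1 = d `^ b by rewrite /d -powRrM mulVf ?gt_eqF// powRr1// ltW.
  rewrite gt0_ltr_powR// ?nnegrE//.
  exact: ltW.
apply: differentiable_continuous; apply/derivable1_diffP.
exact: (dk 0%N x).
Unshelve. all: by end_near. Qed.

Unset Implicit Arguments.
Set Strict Implicit.
Set Printing Implicit Defensive.

Theorem lemma3p19 (R : realType) (d : nat) (d_ge2 : (2 <= d)%N)
    (f : R -> R) (alpha : R)
    (f_periodic : periodic f 1)
    (alpha_gt0 : 0 < alpha) (f_holder : holder_class alpha f)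
    (f_mean : mean f = 0) :
  exists m M : R, [/\ is_min f m, is_max f M
    & forall p : 'rV[R]_d.-1,
        Q_low f p = (if p == 0 then m else mean f)%:E /\
        Q_up f p = (if p == 0 then M else mean f)%:E].
Proof.
have cf := holder_class_continuous f_holder.
have [m [M [fm fM]]] := periodic_bounded cf f_periodic.
have [F [Fper dF]] := periodic_antiderivative cf f_periodic f_mean.
exists m, M; split => // p; rewrite f_mean; split.
  exact: Q_low_value cf f_periodic Fper dF fm.
have crf : continuous (reflected f).
  move=> s; apply: cvgN; apply: (@continuous_comp _ _ _ -%R f).
    exact: opp_continuous.
  exact: cf.
have rper : periodic (reflected f) 1.
  move=> s; rewrite /reflected opprD -[in RHS](subrK 1 (- s)).
  by rewrite f_periodic.
have rFper : periodic (F \o -%R) 1.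
  move=> s; rewrite /= opprD -[in RHS](subrK 1 (- s)).
  by rewrite Fper.
have rdF s : is_derive s (1 : R) (F \o -%R) (reflected f s).
  rewrite /reflected -mulrN1; apply: is_derive1_comp; exact: is_deriveNid.
have rmin : is_min (reflected f) (- M).
  have [[r fr] fle] := fM; split; first by exists (- r); rewrite /reflected opprK fr.
  by move=> s; rewrite lerN2.
rewrite Q_up_reflect (Q_low_value (- p) crf rper rFper rdF rmin) oppr_eq0.
by case: ifP; rewrite -EFinN ?opprK ?oppr0.
Qed.
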